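(* Let $n\ge 1$ and let $K\subseteq \mathbb{R}^{n}\subseteq \mathbb{C}^{n}$ be a compact set. Then $K$ has the strong sharpness property $(SSP)$ in the Polya inequality; that is, there exists $f^{*}\in A(K)^{*}$ such that, for $f'=T(f^{*})$, $$D(f')=d(K).$$
   Context: Multi-indices: $\mathbb{Z}_+^n$ is the set of $n$-vectors of non-negative integers; $z^k=z_1^{k_1}\cdots z_n^{k_n}$, $|k|=k_1+\dots+k_n$. Let $\{k(i)\}_{i\in\mathbb{N}}$, $\mathbb{N}=\{1,2,\dots\}$, be the enumeration of $\mathbb{Z}_+^n$ with $|k(i)|\le |k(i+1)|$ and which on each set $\{|k(i)|=s\}$ coincides with the lexicographic order in $k_1,\dots,k_n$. Put $s(i)=|k(i)|$, $e_\alpha(z)=z^{k(\alpha)}$. Let $m_s=\binom{s+n}{s}$ be the number of multi-indices of degree at most $s$, $N_s$ the number of those of degree exactly $s$, and $l_s=\sum_{q=0}^{s} qN_q$. Transfinite diameter: for a compact set $K\subset\mathbb{C}^n$, let $V_i=\sup\{|\det(e_\alpha(\zeta_\beta))_{\alpha,\beta=1}^{i}| : (\zeta_1,\dots,\zeta_i)\in K^i\}$ and $d(K)=\limsup_{s\to\infty}(V_{m_s})^{1/l_s}$. Functionals: $A(\mathbb{C}^n)$ is the space of entire functions on $\mathbb{C}^n$ with the topology of locally uniform convergence. $A(K)$ is the space of germs of analytic functions on $K$ with the countable inductive limit topology $A(K)=\mathrm{lim\,ind}_{j}\,A(D_j)$, where $D_j$ are open sets with $D_{j+1}\Subset D_j$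 and $K=\bigcap_j D_j$. A star denotes the space of continuous linear functionals; an element of $A(K)^*$ is regarded as an element of $A(\mathbb{C}^n)^*$ by restriction to entire functions. $A_0(\{\infty^n\})$ is the space of analytic germs at $\infty^n=(\infty,\dots,\infty)\in\overline{\mathbb{C}}^n$ with expansion $f'(z)=\sum_{k\in\mathbb{Z}_+^n} a_k/z^{k+I}$, $I=(1,\dots,1)$, converging near $\infty^n$. $T:A(\mathbb{C}^n)^*\to A_0(\{\infty^n\})$ is the isomorphism such that, for $f'=Tf^*$, $f^*(\varphi)=\left(\frac{1}{2\pi i}\right)^n\int_{\mathbb{T}_R^n}\varphi(\zeta)f'(\zeta)\,d\zeta$ for all $\varphi\in A(\mathbb{C}^n)$, where $\mathbb{T}_R^n=\{|z_\nu|=R,\ \nu=1,\dots,n\}$ with $R=R(f^* )$ sufficiently large. Thus the coefficients of $f'=Tf^*$ are $a_k=f^*(z^k)$. Hankel-like determinants: $H_i(f^* )=\det\left(a_{k(\alpha)+k(\beta)}\right)_{\alpha,\beta=1}^{i}$, and $D(f')=\limsup_{i\to\infty}|H_i(f^* )|^{1/(2l_{s(i)})}$. Strong sharpness property: a polynomially convex compact set $K\subset\mathbb{C}^n$ has $(SSP)$ if there is $f^*\in A(K)^*$ with $D(f')=d(K)$ for $f'=T(f^* )$. (Compact subsets of $\mathbb{R}^n$ are polynomially convex in $\mathbb{C}^n$.) *)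

(* Defs.v *)
From HB Require Import structures.
From mathcomp Require Import all_boot all_order all_algebra.
From mathcomp Require Import finmap complex.
From mathcomp Require Import all_classical all_reals all_analysis.
From mathcomp Require Import ring lra.
Set Implicit Arguments.
Unset Strict Implicit.
Unset Printing Implicit Defensive.
Import Order.TTheory GRing.Theory Num.Theory.
Import numFieldNormedType.Exports.
Import Normc.
Local Open Scope classical_set_scope.
Local Open Scope ring_scope.
Local Open Scope complex_scope.

Notation mindex n := {ffun 'I_n -> nat}.

Definition mdeg n (k : mindex n) : nat := (\sum_j k j)%N.

Definition lexle n (k l : mindex n) : bool :=
  ((codom k : seqlexi nat) <= (codom l : seqlexi nat))%O.

Definition level n s : seq (mindex n) :=
  sort (@lexle n)
    [seq [ffun j => nat_of_ord (f j)] | f : {ffun 'I_n -> 'I_s.+1}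
       in [pred f : {ffun 'I_n -> 'I_s.+1} | (\sum_j f j)%N == s]].

(* Indexed from 0: [mindex_enum n i] is k(i+1).  For n > 0 the concatenation of
   the levels of degree at most i has more than i elements. *)
Definition mindex_enum n i : mindex n :=
  nth [ffun=> 0%N] (flatten [seq level n s | s <- iota 0 i.+1]) i.

Definition Nnum n s : nat := size (level n s).
Definition mnum n s : nat := 'C(s + n, s).
Definition lnum n s : nat := (\sum_(q < s.+1) q * Nnum n q)%N.

Section enumeration.
Variable n : nat.
Implicit Types k l : mindex n.

Lemma lexle_trans : transitive (@lexle n).
Proof. by move=> k l m; exact: le_trans. Qed.

Lemma lexle_total : total (@lexle n).
Proof. by move=> k l; exact: le_total. Qed.

Lemma mem_level k s : (k \in level n s) = (mdeg k == s).
Proof.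
rewrite mem_sort; apply/fintype.imageP/eqP => [[f /[!inE]/eqP fs ->]|ks].
  by rewrite /mdeg -[RHS]fs; apply: eq_bigr => j _; rewrite ffunE.
have kle j : (k j < s.+1)%N.
  by rewrite ltnS -ks /mdeg (bigD1 j)//= leq_addr.
exists [ffun j => Ordinal (kle j)].
  by rewrite inE -[X in _ == X]ks /mdeg; apply/eqP/eq_bigr => j _; rewrite ffunE.
by apply/ffunP => j; rewrite !ffunE.
Qed.

Lemma level_uniq s : uniq (level n s).
Proof.
rewrite sort_uniq map_inj_uniq ?enum_uniq// => f g fg.
by apply/ffunP => j; apply: val_inj; move/ffunP/(_ j) : fg; rewrite !ffunE.
Qed.

Definition levels m : seq (mindex n) := flatten [seq level n s | s <- iota 0 m].

Lemma levelsS m : levels m.+1 = levels m ++ level n m.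
Proof. by rewrite /levels -addn1 iotaD map_cat flatten_cat /= cats0. Qed.

Lemma mem_levels k m : (k \in levels m) = (mdeg k < m)%N.
Proof.
apply/flattenP/idP => [[_ /mapP[s + ->]]|km].
  by rewrite mem_iota mem_level => /andP[_ sm] /eqP->.
exists (level n (mdeg k)); last by rewrite mem_level.
by apply: map_f; rewrite mem_iota.
Qed.

Lemma levels_uniq m : uniq (levels m).
Proof.
elim: m => [//|m ih]; rewrite levelsS cat_uniq ih level_uniq andbT /=.
by apply/hasPn => k; rewrite mem_level mem_levels => /eqP ->; rewrite ltnn.
Qed.

Lemma size_levels m : (0 < n)%N -> (m <= size (levels m))%N.
Proof.
move=> n0; elim: m => [//|m ih]; rewrite levelsS size_cat -addn1 leq_add//.
pose k : mindex n := [ffun j => (j == Ordinal n0) * m]%N.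
suff : k \in level n m by case: (level n m).
rewrite mem_level /mdeg (bigD1 (Ordinal n0))//= ffunE eqxx mul1n.
by rewrite big1 ?addn0// => j /negPf; rewrite ffunE => ->.
Qed.

Lemma levels_nth m p i : (i < size (levels m))%N -> (m <= p)%N ->
  nth [ffun=> 0%N] (levels p) i = nth [ffun=> 0%N] (levels m) i.
Proof.
move=> im; elim: p => [|p ih]; first by rewrite leqn0 => /eqP ->.
rewrite leq_eqVlt => /predU1P[->//|]; rewrite ltnS => mp.
rewrite levelsS nth_cat ifT ?ih// (leq_trans im)//.
elim: p mp {ih} => [|p ih]; first by rewrite leqn0 => /eqP ->.
rewrite leq_eqVlt => /predU1P[->//|]; rewrite ltnS => /ih.
by move=> /leq_trans; apply; rewrite levelsS size_cat leq_addr.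
Qed.

Lemma mindex_enumE m i : (0 < n)%N -> (i < size (levels m))%N ->
  mindex_enum n i = nth [ffun=> 0%N] (levels m) i.
Proof.
move=> n0 im; rewrite /mindex_enum -/(levels i.+1).
have [mi|/ltnW im1] := leqP m i.+1; first exact: levels_nth.
by rewrite [RHS](@levels_nth i.+1)// (leq_trans _ (size_levels _ n0)).
Qed.

Lemma levels_sorted m : pairwise
  (fun k l => (mdeg k < mdeg l)%N || (mdeg k == mdeg l) && lexle k l) (levels m).
Proof.
elim: m => [//|m ih]; rewrite levelsS pairwise_cat ih /=; apply/andP; split.
  apply/allrelP => k l; rewrite mem_levels mem_level => km /eqP ->.
  by rewrite km.
have /pairwiseP-P : pairwise (@lexle n) (level n m).
  by rewrite -(sorted_pairwise lexle_trans) sort_sorted//; exact: lexle_total.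
apply/(pairwiseP [ffun=> 0%N]) => i j im jm ij.
have deg u : (u < size (level n m))%N -> mdeg (nth [ffun=> 0%N] (level n m) u) = m.
  by move=> um; apply/eqP; rewrite -mem_level mem_nth.
by rewrite !deg// eqxx P ?orbT.
Qed.

Lemma mindex_enum_bij : (0 < n)%N -> bijective (mindex_enum n).
Proof.
move=> n0.
have szE i : (i < size (levels i.+1))%N by exact: leq_trans (size_levels _ n0).
exists (fun k => index k (levels (mdeg k).+1)) => [i|k]; last first.
  have kl : k \in levels (mdeg k).+1 by rewrite mem_levels.
  by rewrite (@mindex_enumE (mdeg k).+1)// ?index_mem// nth_index.
set k := mindex_enum n i; pose m := maxn i.+1 (mdeg k).+1.
have km : k = nth [ffun=> 0%N] (levels m) i.
  by rewrite (levels_nth (szE i)) ?leq_maxl.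
have km' : k = nth [ffun=> 0%N] (levels m) (index k (levels (mdeg k).+1)).
  rewrite (@levels_nth (mdeg k).+1) ?leq_maxr//; last first.
    by rewrite index_mem mem_levels.
  by rewrite nth_index// mem_levels.
have szS p q : (p <= q)%N -> (size (levels p) <= size (levels q))%N.
  move=> pq; apply: uniq_leq_size (levels_uniq _) _ => l.
  by rewrite !mem_levels => /leq_trans; exact.
apply/eqP; rewrite -(nth_uniq [ffun=> 0%N] _ _ (levels_uniq m)).
- by rewrite -km' -km.
- by rewrite (leq_trans _ (szS _ _ (leq_maxr _ _)))// index_mem mem_levels.
- exact: leq_trans (szE i) (szS _ _ (leq_maxl _ _)).
Qed.

Lemma mindex_enum_glex i j : (0 < n)%N -> (i < j)%N ->
  let k := mindex_enum n i in let l := mindex_enum n j in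
  (mdeg k < mdeg l)%N \/ mdeg k = mdeg l /\ lexle k l.
Proof.
move=> n0 ij k l.
have szj : (j < size (levels j.+1))%N by exact: leq_trans (size_levels _ n0).
have szi := ltn_trans ij szj.
have := levels_sorted j.+1 => /(pairwiseP [ffun=> 0%N])/(_ i j szi szj ij).
rewrite -!mindex_enumE// => /orP[|/andP[/eqP]]; [by left|by right].
Qed.

End enumeration.

#[warning="-redundant-canonical-projection"]
HB.instance Definition _ (R : realType) := NormedModule.copy R[i] (R[i])^o.

Lemma near_eq_differentiable (K : numFieldType) (V W : normedModType K)
    (f g : V -> W) (x : V) :
  {near x, f =1 g} -> differentiable f x -> differentiable g x.
Proof.
move=> fg df.
have fgx : f x = g x by exact: (nbhs_singleton fg).
have dg : g \o shift x = cst (g x) + 'd f x +o_ 0 id.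
  apply/eqaddoE/eqaddoP => e e0.
  have /eqaddoP/(_ e e0) := diff_locally df.
  move: fg; rewrite (near_shift 0) subr0 => fg.
  apply: filterS2 fg => h; rewrite /= => fgh.
  by rewrite /= !fctE /= -fgx -fgh.
have dc : continuous ('d f x) by exact: diff_continuous.
by apply/diff_locallyP; rewrite (diff_unique dc dg).
Qed.

Section analytic.
Variables (R : realType) (n : nat).
Local Notation C := R[i].
Local Notation Cn := 'rV[C]_n.
Implicit Types (D K : set Cn) (f : Cn -> C).

Definition analytic_on D f := forall z, D z -> differentiable f z.

Lemma analytic_on0 D : analytic_on D 0.
Proof. by move=> z _; exact: differentiable_cst. Qed.

Lemma analytic_onP D (a : C) f g :
  analytic_on D f -> analytic_on D g -> analytic_on D (a *: f + g).
Proof.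
move=> Df Dg z Dz; apply: differentiableD; last exact: Dg.
by apply: differentiableZ; exact: Df.
Qed.

Lemma analytic_onS D D' f : D `<=` D' -> analytic_on D' f -> analytic_on D f.
Proof. by move=> DD' D'f z /DD'/D'f. Qed.

(* An element of A(D), D open, is represented by its extension by 0 outside D;
   for D = C^n there is no junk: [anal setT] is the space of entire functions. *)
Definition anal_pred D : {pred Cn -> C} :=
  fun f => `[< analytic_on D f /\ forall z, ~ D z -> f z = 0 >].

Lemma anal_pred_closed D : submod_closed (anal_pred D).
Proof.
split; first by rewrite unfold_in; apply/asboolP; split => //; exact: analytic_on0.
move=> a f g; rewrite !unfold_in => /asboolP[Df f0] /asboolP[Dg g0].
apply/asboolP; split; first exact: analytic_onP.
by move=> z Dz; rewrite !fctE f0// g0// scaler0 addr0.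
Qed.

HB.instance Definition _ D :=
  GRing.isSubmodClosed.Build C (Cn -> C) (anal_pred D) (anal_pred_closed D).

Record anal D := Anal { anal_val :> Cn -> C ; anal_valP : anal_val \in anal_pred D }.

HB.instance Definition _ D := [isSub for @anal_val D].
HB.instance Definition _ D := [Choice of anal D by <:].
HB.instance Definition _ D := [SubChoice_isSubLmodule of anal D by <:].

(* Uniform convergence on the compact subsets of D, i.e. locally uniform
   convergence on D. *)
HB.instance Definition _ D := Uniform.copy (anal D)
  (initial_topology
    (fun f : anal D => (f : Cn -> C) : {family compactly_in D, Cn -> C})).

(* Functions analytic on some open neighbourhood of K; [germs] below identifies
   those that coincide on a neighbourhood of K. *)
Definition near_anal_pred K : {pred Cn -> C} :=
  fun f => `[< exists D, [/\ open D, K `<=` D & analytic_on D f] >].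

Lemma near_anal_pred_closed K : submod_closed (near_anal_pred K).
Proof.
split.
  rewrite unfold_in; apply/asboolP; exists setT.
  by split; [exact: openT| |exact: analytic_on0].
move=> a f g; rewrite !unfold_in => /asboolP[D [oD KD Df]].
move=> /asboolP[D' [oD' KD' D'g]]; apply/asboolP; exists (D `&` D'); split.
- exact: openI.
- by move=> z Kz; split; [exact: KD|exact: KD'].
- apply: analytic_onP; first by apply: analytic_onS Df => z [].
  by apply: analytic_onS D'g => z [].
Qed.

HB.instance Definition _ K := GRing.isSubmodClosed.Build C (Cn -> C)
  (near_anal_pred K) (near_anal_pred_closed K).

Record near_anal K :=
  NearAnal { near_val :> Cn -> C ; near_valP : near_val \in near_anal_pred K }.

HB.instance Definition _ K := [isSub for @near_val K].
HB.instance Definition _ K := [Choice of near_anal K by <:].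
HB.instance Definition _ K := [SubChoice_isSubLmodule of near_anal K by <:].

Definition null_pred K : {pred near_anal K} :=
  fun h : near_anal K =>
    `[< exists D, [/\ open D, K `<=` D & forall z, D z -> h z = 0] >].
Arguments null_pred : clear implicits.

Lemma null_pred_closed K : submod_closed (null_pred K).
Proof.
split.
  by rewrite unfold_in; apply/asboolP; exists setT; split; first exact: openT.
move=> a f g; rewrite !unfold_in => /asboolP[D [oD KD f0]].
move=> /asboolP[D' [oD' KD' g0]]; apply/asboolP; exists (D `&` D'); split.
- exact: openI.
- by move=> z Kz; split; [exact: KD|exact: KD'].
- by move=> z [Dz D'z]; rewrite /= !fctE f0// g0// scaler0 addr0.
Qed.

HB.instance Definition _ K := GRing.isSubmodClosed.Build C (near_anal K)
  (null_pred K) (null_pred_closed K).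

End analytic.

Section germs.
Variables (R : realType) (n : nat).
Local Notation C := R[i].
Local Notation Cn := 'rV[C]_n.
Implicit Types D K : set Cn.
Local Open Scope quotient_scope.

Definition germs K := Quotient.quot (@null_pred R n K).

HB.instance Definition _ K := GRing.Zmodule.on (germs K).

Lemma germs_eqP K (f g : near_anal K) :
  \pi_(germs K) f = \pi_(germs K) g <-> f - g \in @null_pred R n K.
Proof. by rewrite Quotient.idealrBE; split => /eqP. Qed.

Definition germs_scale K (a : C) (x : germs K) : germs K :=
  \pi_(germs K) (a *: repr x).

Lemma germs_scaleE K a (f : near_anal K) :
  germs_scale a (\pi_(germs K) f) = \pi_(germs K) (a *: f).
Proof.
apply/germs_eqP; rewrite -scalerBr; apply: rpredZ.
by apply/germs_eqP; rewrite reprK.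
Qed.

Lemma germsD K (f g : near_anal K) :
  \pi_(germs K) (f + g) = \pi_(germs K) f + \pi_(germs K) g.
Proof. exact: (@pi_addr _ _ _ _ _ (Quotient.quot (@null_pred R n K))). Qed.

Lemma germsW K (x : germs K) : exists f, x = \pi_(germs K) f.
Proof. by exists (repr x); rewrite reprK. Qed.

Lemma germs_scaleA K a b (x : germs K) :
  germs_scale a (germs_scale b x) = germs_scale (a * b) x.
Proof. by have [f ->] := germsW x; rewrite !germs_scaleE scalerA. Qed.

Lemma germs_scale1 K : left_id 1 (@germs_scale K).
Proof. by move=> x; have [f ->] := germsW x; rewrite germs_scaleE scale1r. Qed.

Lemma germs_scaleDr K : right_distributive (@germs_scale K) +%R.
Proof.
move=> a x y; have [f ->] := germsW x; have [g ->] := germsW y.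
by rewrite -germsD !germs_scaleE -germsD scalerDr.
Qed.

Lemma germs_scaleDl K x : {morph (@germs_scale K)^~ x : a b / a + b}.
Proof.
by move=> a b; have [f ->] := germsW x; rewrite !germs_scaleE -germsD scalerDl.
Qed.

HB.instance Definition _ K := GRing.Zmodule_isLmodule.Build C (germs K)
  (@germs_scaleA K) (@germs_scale1 K) (@germs_scaleDr K) (@germs_scaleDl K).

Lemma anal_near K D (oD : open D) (KD : K `<=` D) (f : anal D) :
  (f : Cn -> C) \in near_anal_pred K.
Proof.
case: f => f /=; rewrite !unfold_in => /asboolP[Df _].
by apply/asboolP; exists D.
Qed.

Definition germ K D (oD : open D) (KD : K `<=` D) (f : anal D) : germs K :=
  \pi_(germs K) (NearAnal (anal_near oD KD f)).

Lemma germ_linear K D (oD : open D) (KD : K `<=` D) : linear (germ oD KD).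
Proof.
move=> a f g; rewrite /germ -[RHS]/(germs_scale a _ + _).
by rewrite germs_scaleE -germsD; congr (\pi_(germs K) _); exact: val_inj.
Qed.

HB.instance Definition _ K D (oD : open D) (KD : K `<=` D) :=
  GRing.isLinear.Build C (anal D) (germs K) *:%R (germ oD KD)
    (germ_linear oD KD).

Lemma germ_eqP K D D' (oD : open D) (KD : K `<=` D) (oD' : open D')
    (KD' : K `<=` D') (f : anal D) (g : anal D') :
  germ oD KD f = germ oD' KD' g <->
  exists U, [/\ open U, K `<=` U & forall z, U z -> f z = g z].
Proof.
rewrite germs_eqP unfold_in; split => [/asboolP|] [U [oU KU fg]].
  exists U; split => // z Uz; apply/eqP; rewrite -subr_eq0; apply/eqP.
  exact: fg.
by apply/asboolP; exists U; split => // z Uz; rewrite /= !fctE /= fg// subrr.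
Qed.

(* The open sets D_j; see [nbd_exhaustion] for D_{j+1} relatively compact in D_j
   and K the intersection of the D_j. *)
Definition nbd K (j : nat) : set Cn := \bigcup_(z in K) ball z (j.+1%:R^-1 : C).

Lemma open_nbd K j : open (nbd K j).
Proof. by apply: bigcup_open => z _; exact: ball_open. Qed.

Lemma sub_nbd K j : K `<=` nbd K j.
Proof. by move=> z Kz; exists z => //; exact: ballxx. Qed.

(* A(K) carries the locally convex inductive limit topology, the finest locally
   convex one making all the maps A(D_j) -> A(K) continuous: a base of
   neighbourhoods of 0 is given by the absolutely convex sets whose preimages in
   all the A(D_j) are neighbourhoods of 0 (such sets are absorbing). *)
Definition indlim_nbhs0 K (U : set (germs K)) : Prop :=
  (forall (x y : germs K) (a b : C), U x -> U y -> `|a| + `|b| <= 1 ->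
     U (a *: x + b *: y)) /\
  (forall j, nbhs (0 : anal (nbd K j))
     (germ (@open_nbd K j) (@sub_nbd K j) @^-1` U)).

Definition germs_open K : set_system (germs K) :=
  [set O | forall x, O x ->
     exists2 U, indlim_nbhs0 U & forall y, U y -> O (x + y)].

Lemma germs_openT K : @germs_open K setT.
Proof.
move=> x _; exists setT => //; split => // j; rewrite preimage_setT.
exact: filterT.
Qed.

Lemma germs_openI K : setI_closed (@germs_open K).
Proof.
move=> A B oA oB x [/oA[U [Uc Un] UA] /oB[V [Vc Vn] VB]].
exists (U `&` V).
  split; first by move=> y z a b [Uy Vy] [Uz Vz] ab; split; [exact: Uc|exact: Vc].
  by move=> j; rewrite preimage_setI; apply: filterI; [exact: Un|exact: Vn].
by move=> y [/UA ? /VB].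
Qed.

Lemma germs_open_bigU K (I : Type) (F : I -> set (germs K)) :
  (forall i, germs_open (F i)) -> germs_open (\bigcup_i F i).
Proof.
move=> oF x [i _ /oF[U U0 UF]]; exists U => // y /UF Fy.
by exists i.
Qed.

HB.instance Definition _ K := isOpenTopological.Build (germs K)
  (@germs_openT K) (@germs_openI K) (@germs_open_bigU K).

End germs.

Record dual (K : numFieldType) (E : preTopologicalLmodType K) := Dual {
  dual_val :> {linear E -> K^o} ;
  dual_cont : continuous dual_val
}.

Section restriction.
Variables (R : realType) (n : nat).
Local Notation C := R[i].
Local Notation Cn := 'rV[C]_n.
Implicit Types D K : set Cn.

Lemma anal_res_subproof D (oD : open D) (f : anal [set: Cn]) :
  ((f : Cn -> C) \_ D) \in anal_pred D.
Proof.
case: f => f /=; rewrite !unfold_in => /asboolP[Df _]; apply/asboolP.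
split=> z Dz; last by rewrite patchN// notin_setE.
apply: near_eq_differentiable (Df z I); near=> w.
have Dw : D w by near: w; exact: open_nbhs_nbhs.
by rewrite patchT// inE.
Unshelve. all: by end_near. Qed.

Definition anal_res D (oD : open D) (f : anal [set: Cn]) : anal D :=
  Anal (anal_res_subproof oD f).

Lemma anal_cvg (T : Type) (F : set_system T) (FF : Filter F) D
    (h : T -> anal D) (f : anal D) :
  (forall L (e : C), L `<=` D -> compact L -> 0 < e ->
     \forall t \near F, forall z, L z -> `|f z - h t z| < e) ->
  h @ F --> f.
Proof.
move=> hf A [_ [[B oB <-] Bf BA]].
have fB : nbhs ((f : Cn -> C) : {family compactly_in D, Cn -> C}) B.
  exact: open_nbhs_nbhs.
suff : (fun t => (h t : Cn -> C)) @ F -->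
       ((f : Cn -> C) : {family compactly_in D, Cn -> C}).
  move=> /(_ _ fB) FB; change (F (h @^-1` A)).
  by apply: (@filterS _ F FF _ _ _ FB) => t; exact: BA.
apply/fam_cvgP => L [LD cL] P /uniform_nbhs[E [/= entE EP]].
move: entE; rewrite -entourage_ballE => -[e /= e0 eE].
have := hf _ _ LD cL e0; apply: filterS => t ht; apply: EP => z Lz.
by apply: eE; rewrite /= -ball_normE; exact: ht.
Qed.

Lemma anal_nbhs D (f : anal D) (L : set Cn) (e : C) :
  L `<=` D -> compact L -> 0 < e ->
  nbhs f [set g : anal D | forall z, L z -> `|f z - g z| < e].
Proof.
move=> LD cL e0.
have entE : entourage [set xy : C * C | ball xy.1 e xy.2].
  by rewrite -entourage_ballE; exists e.
have fE := @initial_continuous _ _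
  (fun f : anal D => (f : Cn -> C) : {family compactly_in D, Cn -> C}) f _
  (@fam_nbhs _ _ (compactly_in D) L _ (f : Cn -> C) entE (conj LD cL)).
apply: (@filterS _ (nbhs f) _ _ _ _ fE) => g fg z /fg.
by rewrite -ball_normE.
Qed.

Lemma germT_continuous K :
  continuous (germ (@openT Cn) (@subsetT _ K) : anal setT -> germs K).
Proof.
move=> f A [B [oB Bf BA]].
have [U [Uc Un] UO] := oB _ Bf.
have Un0 := Un 0%N.
pose r (g : anal [set: Cn]) := anal_res (@open_nbd _ _ K 0) (g - f).
have rf : r @ nbhs f --> (0 : anal (nbd K 0)).
  apply: anal_cvg => L e LK cL e0.
  apply: filterS (anal_nbhs f (@subsetT _ L) cL e0) => g fg z Lz.
  by rewrite /r /= patchT ?inE; [rewrite !fctE sub0r opprB; exact: fg|exact: LK].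
apply: (@filterS _ (nbhs f) _ _ _ _ (rf _ Un0)) => g Ug; apply: BA.
have -> : germ (@openT Cn) (@subsetT _ K) g =
    germ (@openT Cn) (@subsetT _ K) f +
    germ (@open_nbd _ _ K 0) (@sub_nbd _ _ K 0) (r g).
  rewrite addrC; apply/eqP; rewrite -subr_eq -linearB; apply/eqP/germ_eqP.
  exists (nbd K 0); split; [exact: open_nbd|exact: sub_nbd|move=> z Kz].
  by rewrite /r /= patchT ?inE.
exact: UO.
Qed.

End restriction.

(* Restriction of a functional on A(K) to the entire functions. *)
Definition dual_entire (R : realType) (n : nat) (K : set 'rV[R[i]]_n)
    (F : dual (germs K)) : dual (anal [set: 'rV[R[i]]_n]) :=
  @Dual _ (anal setT) (F \o germ (@openT 'rV[R[i]]_n) (@subsetT _ K))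
    (fun f => continuous_comp (@germT_continuous _ _ K f) (@dual_cont _ _ F _)).

Definition monom (R : realType) n (k : mindex n) (z : 'rV[R[i]]_n) : R[i] :=
  \prod_j z ord0 j ^+ k j.

Section transform.
Variables (R : realType) (n : nat).
Local Notation C := R[i].
Local Notation Cn := 'rV[C]_n.
Implicit Types (k : mindex n) (z : Cn).

Lemma monom_anal_subproof k : (monom k : Cn -> C) \in anal_pred setT.
Proof.
rewrite unfold_in; apply/asboolP; split=> [z _|z /(_ I)//].
have -> : (monom k : Cn -> C) = \prod_j ((fun w => w ord0 j) ^+ k j).
  apply/funext => w; rewrite /monom fct_prodE; apply: eq_bigr => j _.
  by rewrite exprfctE.
elim/big_rec : _ => [|j f _ df]; first exact: differentiable_cst.
apply: differentiableM => //.
elim: (k j) => [|m ih]; first exact: differentiable_cst.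
by rewrite exprS; apply: differentiableM ih; exact: differentiable_coord.
Qed.

Definition monom_anal k : anal [set: Cn] := Anal (monom_anal_subproof k).

Lemma normCE (x : C) : `|x| = (normc x)%:C. Proof. by []. Qed.

Lemma normc_ge0 (x : C) : 0 <= normc x.
Proof. by case: x => a b; exact: sqrtr_ge0. Qed.

Lemma normcX (x : C) m : normc (x ^+ m) = normc x ^+ m.
Proof. by elim: m => [|m ih]; rewrite ?normc1// !exprS normcM ih. Qed.

Lemma normc_nat m : normc (m%:R : C) = m%:R.
Proof.
by rewrite -(rmorph_nat (real_complex R)) /= expr0n /= addr0 sqrtr_sqr ger0_norm.
Qed.

Lemma normc_monom k z : normc (monom k z) = \prod_j normc (z ord0 j) ^+ k j.
Proof.
rewrite /monom; elim/big_ind2 : _ => [|x a y b xa yb|j _]; first exact: normc1.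
- by rewrite normcM xa yb.
- exact: normcX.
Qed.

Lemma normc_lipschitz (x y : C) : `|normc x - normc y| <= normc (x - y).
Proof.
have := ler_dist_dist x y; rewrite !normCE -rmorphB /= lecR.
by rewrite expr0n /= addr0 sqrtr_sqr.
Qed.

Lemma normc_continuous : continuous (@normc R : C -> R).
Proof.
move=> x; apply/(cvgrPdist_lt (F := nbhs x)) => e e0.
apply/nbhs_ballP; exists e%:C; first by rewrite /= ltcR.
move=> y; rewrite -ball_normE /= ltcR.
exact/le_lt_trans/normc_lipschitz.
Qed.

Lemma compact_normc_bounded (L : set Cn) : compact L ->
  exists2 r : nat, (0 < r)%N & forall z j, L z -> normc (z ord0 j) <= r%:R.
Proof.
move=> cL.
have bj j : exists r : nat, forall z, L z -> normc (z ord0 j) <= r%:R.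
  have cf : continuous (fun z : Cn => normc (z ord0 j)).
    move=> z; apply: (@continuous_comp _ _ _ (fun z : Cn => z ord0 j)).
      exact: coord_continuous.
    exact: normc_continuous.
  have /compact_bounded[M [_ ML]] :=
    continuous_compact (continuous_subspaceT cf) cL.
  have [r Mr] : exists r : nat, M < r%:R.
    exists (Num.truncn `|M|).+1; rewrite (le_lt_trans (ler_norm _))//.
    by rewrite truncnS_gt.
  exists r => z Lz; have := ML _ Mr _ (imageP _ Lz).
  by rewrite /= ger0_norm// normc_ge0.
have [r rP] := choice bj; exists (\sum_j r j).+1 => // z j Lz.
rewrite (le_trans (rP j z Lz))// ler_nat (bigD1 j)//= ltnW// ltnS.
exact: leq_addr.
Qed.

Lemma functional_monom_bound (F : dual (anal [set: Cn])) :
  exists2 N : nat, (0 < N)%N &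
    forall k, normc (F (monom_anal k)) <= N%:R ^+ (mdeg k).+1.
Proof.
apply: contrapT => noN.
have bad (N : nat) : exists k, N.+1%:R ^+ (mdeg k).+1 < normc (F (monom_anal k)).
  apply: contrapT => h; apply: noN; exists N.+1 => // k.
  by rewrite leNgt; apply/negP => hk; apply: h; exists k.
have [k kP] := choice bad.
pose c (N : nat) : C := (N.+1%:R ^+ (mdeg (k N)).+1)^-1.
pose phi N : anal [set: Cn] := c N *: monom_anal (k N).
have phi0 : phi @ \oo --> (0 : anal [set: Cn]).
  apply: anal_cvg => L e _ cL e0.
  have [r r0 rL] := compact_normc_bounded cL.
  have [a a0 ae] : exists2 a : R, 0 < a & e = a%:C.
    by case: e e0 => a b; rewrite ltcE /= => /andP[/eqP -> a0]; exists a.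
  near=> N => z Lz; rewrite /phi /= !fctE sub0r normrN normCE ae ltcR normcM.
  have kr : normc (monom (k N) z) <= N.+1%:R ^+ mdeg (k N).
    rewrite normc_monom /mdeg expr_sum; apply: ler_prod => j _.
    rewrite exprn_ge0 ?normc_ge0//= lerXn2r ?nnegrE ?normc_ge0//.
    rewrite (le_trans (rL z j Lz))// ler_nat ltnW// ltnS.
    by near: N; exact: nbhs_infty_ge.
  have -> : normc (c N) = (N.+1%:R ^+ (mdeg (k N)).+1)^-1.
    by rewrite /c normcV normcX normc_nat.
  apply: (@le_lt_trans _ _ N.+1%:R^-1).
    by rewrite ler_pdivrMl ?exprn_gt0// exprSr mulfK ?pnatr_eq0.
  by near: N; exact: near_infty_natSinv_lt (PosNum a0).
have Fphi : F (phi N) @[N --> \oo] --> (0 : C).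
  have := @dual_cont _ _ F 0; rewrite /continuous_at linear0 => F0.
  exact: (cvg_comp _ _ phi0 F0).
have /(cvgrPdist_lt (F := \oo))/(_ 1 ltr01)[N _ /(_ N (leqnn N))] := Fphi.
rewrite sub0r normrN /phi linearZ normCE.
rewrite -[1]/(1%:C) ltcR normcM /c normcV normcX normc_nat.
apply/negP; rewrite -leNgt ler_pdivlMl ?exprn_gt0// mulr1.
exact/ltW/kP.
Unshelve. all: by end_near. Qed.

End transform.

(* A_0({oo^n}): the germ with expansion sum_k a_k / z^(k+I) convergent near oo^n
   is represented by its coefficients a_k; here I = (1,...,1). *)
Record germ_infty (R : realType) n := GermInfty {
  coef :> mindex n -> R[i] ;
  coef_cvg : exists2 r : R, 0 < r &
    forall z : 'rV[R[i]]_n, (forall j, r < normc (z ord0 j)) ->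
      (\esum_(k in [set: mindex n])
         (normc (coef k / monom (k + [ffun=> 1%N]) z))%:E < +oo)%E
}.

Section transform_cvg.
Variables (R : realType) (n : nat).
Local Notation C := R[i].
Local Notation Cn := 'rV[C]_n.
Implicit Types (k : mindex n) (z : Cn).

Lemma geometric_mindex_sum (A : set (mindex n)) : finite_set A ->
  \sum_(k \in A) \prod_j (2^-1 : R) ^+ k j <= 2 ^+ n.
Proof.
move=> finA; rewrite fsbig_finite//=; set s := enum_fset _.
pose M := (\max_(k <- s) \max_j k j).+1.
pose t := [seq [ffun j => nat_of_ord (f j)] | f : {ffun 'I_n -> 'I_M}].
pose g k : R := \prod_j 2^-1 ^+ k j.
have g0 k : 0 <= g k by apply: prodr_ge0 => j _; rewrite exprn_ge0.
have tu : uniq t.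
  rewrite map_inj_uniq ?enum_uniq// => f h fh; apply/ffunP => j; apply: val_inj.
  by move/ffunP/(_ j) : fh; rewrite !ffunE.
have st k : k \in s -> k \in t.
  move=> ks; have kM j : (k j < M)%N.
    rewrite ltnS; apply: (@leq_trans (\max_j k j)).
      exact: (@leq_bigmax _ (fun j => k j)).
    by rewrite (big_rem k)//= leq_maxl.
  apply/mapP; exists [ffun j => Ordinal (kM j)]; first by rewrite mem_enum.
  by apply/ffunP => j; rewrite !ffunE.
have -> : \sum_(k <- s) g k = \sum_(k <- t | k \in s) g k.
  rewrite -[RHS]big_filter; apply: perm_big; apply: uniq_perm.
  - exact: fset_uniq.
  - exact: filter_uniq.
  - by move=> k; rewrite mem_filter andb_idr//; exact: st.
apply: (@le_trans _ _ (\sum_(k <- t) g k)).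
  by rewrite [leRHS](bigID (fun k => k \in s))/= lerDl sumr_ge0.
rewrite big_image /=.
have -> : \sum_(f : {ffun 'I_n -> 'I_M}) g [ffun j => nat_of_ord (f j)] =
    \prod_(j < n) \sum_(i < M) (2^-1 : R) ^+ i.
  rewrite bigA_distr_bigA; apply: eq_bigr => f _; apply: eq_bigr => j _.
  by rewrite ffunE.
rewrite prodr_const card_ord lerXn2r ?nnegrE ?sumr_ge0//.
have := subrX1 (2^-1 : R) M.
have : 0 <= (2^-1 : R) ^+ M by rewrite exprn_ge0.
by move: (\sum_(_ < _) _) (_ ^+ M) => S q q0 SE; lra.
Qed.

Lemma transform_cvg (a : mindex n -> C) (N : nat) : (0 < N)%N ->
  (forall k, normc (a k) <= N%:R ^+ (mdeg k).+1) ->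
  exists2 r : R, 0 < r & forall z, (forall j, r < normc (z ord0 j)) ->
    (\esum_(k in [set: mindex n])
       (normc (a k / monom (k + [ffun=> 1%N]) z))%:E < +oo)%E.
Proof.
move=> N0 aN; exists (N%:R * 2) => [|z rz]; first by rewrite mulr_gt0// ltr0n.
have z0 j : 0 < normc (z ord0 j).
  by apply: le_lt_trans (rz j); rewrite mulr_ge0.
pose c := N%:R * \prod_j (normc (z ord0 j))^-1.
have c0 : 0 <= c.
  by rewrite mulr_ge0// prodr_ge0// => j _; rewrite invr_ge0 ltW.
have bd k : normc (a k / monom (k + [ffun=> 1%N]) z) <= c * \prod_j 2^-1 ^+ k j.
  rewrite normcM normcV normc_monom.
  have -> : (\prod_j normc (z ord0 j) ^+ (k + [ffun=> 1%N])%R j)^-1 =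
      \prod_j (normc (z ord0 j))^-1 * \prod_j (normc (z ord0 j))^-1 ^+ k j.
    rewrite -big_split -prodfV; apply: eq_bigr => j _.
    by rewrite -exprVn !ffunE -[(k j + 1)%R]/(k j + 1)%N addn1 exprS.
  apply: le_trans (ler_wpM2r _ (aN k)) _.
    by rewrite mulr_ge0// prodr_ge0// => j _; rewrite ?exprn_ge0// invr_ge0 ltW.
  rewrite exprS mulrACA ler_wpM2l//.
  rewrite /mdeg expr_sum -big_split /=; apply: ler_prod => j _.
  rewrite -exprMn exprn_ge0 ?mulr_ge0 ?invr_ge0 ?(ltW (z0 j))//=.
  rewrite lerXn2r ?nnegrE ?mulr_ge0 ?invr_ge0 ?(ltW (z0 j))//.
  by rewrite ler_pdivrMr// ler_pdivlMl// mulrC ltW.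
apply: (@le_lt_trans _ _ (c * 2 ^+ n)%:E); last exact: ltry.
apply: ub_ereal_sup => _ [A [finA _] <-].
rewrite fsbig_finite//= sumEFin lee_fin.
apply: le_trans (ler_wpM2l c0 (geometric_mindex_sum finA)).
rewrite [in leRHS]fsbig_finite//= mulr_sumr; apply: ler_sum => k _; exact: bd.
Qed.

Lemma transform_cvg_functional (F : dual (anal [set: Cn])) :
  exists2 r : R, 0 < r & forall z, (forall j, r < normc (z ord0 j)) ->
    (\esum_(k in [set: mindex n])
       (normc (F (monom_anal R k) / monom (k + [ffun=> 1%N]) z))%:E < +oo)%E.
Proof. by have [N N0] := functional_monom_bound F; exact: transform_cvg. Qed.

End transform_cvg.

Section nbd_exhaustion.
Variables (R : realType) (n : nat).
Local Notation C := R[i].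
Local Notation Cn := 'rV[C]_n.

Lemma compact_disk (M : R) : compact [set w : C | normc w <= M].
Proof.
have cc : continuous (fun p : R * R => (p.1 +i* p.2 : C)).
  move=> [x y]; apply/(cvgrPdist_lt (F := nbhs (x, y))) => e e0.
  have [a a0 ae] : exists2 a : R, 0 < a & e = a%:C.
    by case: e e0 => a b; rewrite ltcE /= => /andP[/eqP -> a0]; exists a.
  have a2 : 0 < a / 2 by rewrite divr_gt0.
  apply/nbhs_ballP; exists (a / 2) => //= -[u v] [/=].
  rewrite -!ball_normE /= => xu yv.
  rewrite normCE ae ltcR.
  have -> : ((x +i* y) - (u +i* v) : C) = (x - u)%:C + 'i%C * (y - v)%:C.
    by apply/eqP; rewrite eq_complex /=; apply/andP; split; apply/eqP; ring.
  apply: (le_lt_trans (le_normcD _ _)); rewrite normcM /=.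
  rewrite !expr0n /= !addr0 add0r expr1n sqrtr1 mul1r !sqrtr_sqr.
  by rewrite [a]splitr ltrD.
have cb : compact (`[- M, M] `*` `[- M, M] : set (R * R)).
  by apply: compact_setX; exact: segment_compact.
have /subclosed_compact := continuous_compact (continuous_subspaceT cc) cb.
apply.
- rewrite (_ : mkset _ = @normc R @^-1` [set x | x <= M])//.
  by apply: closed_comp => [w _|]; [exact: normc_continuous|exact: closed_le].
- move=> -[x y] /= xyM; exists (x, y) => //=.
  have M0 : 0 <= M by exact: le_trans xyM.
  have sq (t s : R) : Num.sqrt (t ^+ 2 + s ^+ 2) <= M -> `|t| <= M.
    apply: le_trans; rewrite -sqrtr_sqr ler_sqrt ?lerDl ?sqr_ge0//.
    by rewrite addr_ge0 ?sqr_ge0.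
  split; rewrite /= in_itv /= -ler_norml; first exact: sq xyM.
  by apply: sq; rewrite addrC; exact: xyM.
Qed.

Lemma compact_polydisk (M : R) :
  compact [set z : Cn | forall j, normc (z ord0 j) <= M].
Proof.
apply: (@rV_compact _ _ (fun=> [set w : C | normc w <= M])) => _.
exact: compact_disk.
Qed.

Lemma nbd_exhaustion (K : set Cn) : compact K ->
  [/\ forall j, open (nbd K j),
      forall j, compact (closure (nbd K j.+1)) /\
                closure (nbd K j.+1) `<=` nbd K j &
      K = \bigcap_j nbd K j].
Proof.
move=> cK; split => [j|j|]; first exact: open_nbd.
- have lt_inv : (j.+2%:R^-1 : C) < j.+1%:R^-1.
    by rewrite ltf_pV2 ?posrE ?ltr0n// ltr_nat.
  split.
    have [r _ rK] := compact_normc_bounded cK.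
    apply: (subclosed_compact _ (@compact_polydisk (r%:R + 2))).
      exact: closed_closure.
    move=> z cz i; have [w [[x Kx xw] zw]] := cz _ (nbhsx_ballx z 1 ltr01).
    rewrite -(subrK (x ord0 i) (z ord0 i)) addrC.
    apply: le_trans (le_normcD _ _) _; apply: lerD; first exact: rK.
    have : ball x 2 z.
      rewrite -[2]/(1 + 1); apply: ball_triangle (ball_sym zw).
      by apply: le_ball xw; rewrite invf_le1 ?ler1n ?ltr0n.
    move=> [_ /(_ ord0 i)]; rewrite -ball_normE /= distrC => /ltW.
    by rewrite -(rmorph_nat (real_complex R)) normCE lecR.
  move=> z cz.
  have d0 : (0 : C) < j.+1%:R^-1 - j.+2%:R^-1 by rewrite subr_gt0.
  have [w [[x Kx xw] zw]] := cz _ (nbhsx_ballx z _ d0).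
  exists x => //; have := ball_triangle xw (ball_sym zw).
  by rewrite addrC subrK.
- apply/seteqP; split=> [z Kz j _|z zK]; first exact: sub_nbd.
  have : closure K z.
    move=> A /nbhs_ballP[e e0 eA].
    have [a a0 ae] : exists2 a : R, 0 < a & e = a%:C.
      by case: e e0 {eA} => a b; rewrite /= ltcE /= => /andP[/eqP -> a0]; exists a.
    have [N _ /(_ N (leqnn N)) Na] := near_infty_natSinv_lt (PosNum a0).
    have [x Kx xz] := zK N I; exists x; split => //.
    apply: eA; apply: ball_sym; apply: le_ball xz.
    rewrite ae -(rmorph_nat (real_complex R)) -fmorphV lecR; exact: ltW.
  by rewrite -(closure_id _).1//; exact: compact_closed.
Qed.

End nbd_exhaustion.

Section functionals.
Variables (R : realType) (n : nat).
Local Notation C := R[i].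
Local Notation Cn := 'rV[C]_n.

(* The isomorphism T : A(C^n)^* -> A_0({oo^n}).  Testing the defining formula
   F(phi) = (2 pi i)^-n \int phi f' on phi = z^k picks out the coefficient a_k of
   f', so T F is the germ with a_k = F(z^k). *)
Definition transform (F : dual (anal [set: Cn])) : germ_infty R n :=
  GermInfty (transform_cvg_functional F).

Definition hankel (a : germ_infty R n) (i : nat) : C :=
  \det (\matrix_(p < i, q < i) a (mindex_enum n p + mindex_enum n q)).

(* s(i) = |k(i)| is the degree of [mindex_enum n i.-1]. *)
Definition hankel_diam (a : germ_infty R n) : \bar R :=
  limn_esup (fun i => (normc (hankel a i) `^
    (2 * lnum n (mdeg (mindex_enum n i.-1)))%:R^-1)%:E).

Definition vandermonde_sup (K : set Cn) (i : nat) : R :=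
  sup [set normc (\det (\matrix_(p < i, q < i) monom (mindex_enum n p) (zeta q)))
      | zeta in [set zeta : 'I_i -> Cn | forall q, K (zeta q)]].

Definition transfinite_diam (K : set Cn) : \bar R :=
  limn_esup (fun s =>
    (vandermonde_sup K (mnum n s) `^ (lnum n s)%:R^-1)%:E).

Definition SSP (K : set Cn) : Prop :=
  exists F : dual (germs K),
    hankel_diam (transform (dual_entire F)) = transfinite_diam K.

Definition real_space : set Cn := [set z | forall j, complex.Im (z ord0 j) = 0].

End functionals.

(* Main.v *)
From HB Require Import structures.
Require Import Defs.
From mathcomp Require Import all_fingroup all_boot all_order all_algebra.
From mathcomp Require Import complex.
From mathcomp Require Import all_classical all_reals all_analysis.
From mathcomp Require Import ring lra zify.
Set Implicit Arguments.
Unset Strict Implicit.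
Unset Printing Implicit Defensive.
Import Order.TTheory GRing.Theory Num.Theory.
Import numFieldNormedType.Exports.
Import Normc.
Local Open Scope classical_set_scope.
Local Open Scope ring_scope.

(** A finite positive measure [mu] carried by [K] defines the functional
    [f |-> \int f dmu] on [A(K)], with [a_k = \int x^k dmu].  As [K] is real,
    its Hankel determinants are Gram determinants, and the Andreief identity
    ([det_weighted_gram]) gives
      [i! H_i = \int |det (e_p (x_q))|^2 dmu(x_1) .. dmu(x_i)].
    So [H_i <= V_i^2] if [mu] has mass at most 1, while [H_(m_s)] is at least
    [V_(m_s)^2] up to the factor [c^(m_s) / (4 m_s!)] as soon as [mu] gives mass
    [c] to each point of a configuration where the determinant exceeds
    [V_(m_s) / 2].

    Since [(n + 1) l_s = n s m_s] ([lnum_mnum]), a factor [q(s)^(m_s)], [q] a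
    polynomial, has [l_s]-th root tending to 1 ([subexponential_mnum]).  The
    weights only have to be summable over the blocks of [m_s <= (s + 1)^n]
    points, so a polynomial decay of [c] is affordable, and the discrete measure
    charging a near-maximal configuration for every [s] ([fekete_functional])
    satisfies both bounds with such a factor as the only loss.  This yields
    [d(K) <= D(f')] along the indices [i = m_s].

    The converse inequality also involves the indices strictly between [m_s] and
    [m_(s+1)].  Laplace expansion gives [V_(j+1) <= (j + 1) r^|k(j+1)| V_j], and
    passing from [m_s] to [i <= m_(s+1)] takes at most [N_(s+1)] such steps.
    From [(s + 1) N_(s+1) = n m_s] ([Nnum_mnum]) these steps, and the difference
    of [l_s] and [l_(s+1)], again contribute at most a factor [q^(m_(s+1))]
    ([vandermonde_sup_le]). *)

(** * Counting multi-indices *)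

Section counting.
Variable n : nat.
Implicit Types (s m j : nat) (k : mindex n).

Lemma size_levels_mnum s : size (levels n s.+1) = mnum n s.
Proof.
rewrite /mnum addnC -[RHS]bin_sub ?leq_addl// addnK.
rewrite -card_partial_ord_partitions.
pose g (t : n.-tuple 'I_s.+1) : mindex n := [ffun j => nat_of_ord (tnth t j)].
have sumg t : mdeg (g t) = (\sum_(i <- t) i)%N.
  by rewrite big_tuple; apply: eq_bigr => j _; rewrite ffunE.
have g_inj : injective g.
  move=> t u tu; apply: eq_from_tnth => j; apply: val_inj.
  by move/ffunP/(_ j) : tu; rewrite !ffunE.
pose A := [set t : n.-tuple 'I_s.+1 | (\sum_(i <- t) i <= s)%N]%SET.
rewrite -[RHS](size_image g A); apply/perm_size/uniq_perm.
- exact: levels_uniq.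
- by rewrite map_inj_uniq ?enum_uniq.
move=> k; rewrite mem_levels ltnS; apply/idP/fintype.imageP => [ks|[t]].
  have kle (i : 'I_n) : (k i < s.+1)%N.
    by rewrite ltnS (leq_trans _ ks)// /mdeg (bigD1 i)//= leq_addr.
  exists [tuple Ordinal (kle i) | i < n].
    rewrite inE -sumg (_ : g _ = k)//; apply/ffunP => j.
    by rewrite ffunE tnth_mktuple.
  by apply/ffunP => j; rewrite ffunE tnth_mktuple.
by rewrite inE -sumg => + ->.
Qed.

(** The enumeration is by blocks of constant degree, so degrees can be read off
    from positions. *)
Lemma mdeg_mindex_enum m j : (0 < n)%N ->
  (mdeg (mindex_enum n j) < m)%N = (j < size (levels n m))%N.
Proof.
move=> n0; apply/idP/idP => [jm|jm]; last first.
  by rewrite (mindex_enumE n0 jm) -mem_levels mem_nth.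
rewrite ltnNge; apply/negP => mj.
have jj : (j < size (levels n j.+1))%N by exact: size_levels.
have mjS : (m <= j.+1)%N.
  rewrite leqNgt; apply/negP => jSm.
  by have := leq_trans jSm (leq_trans (size_levels m n0) mj);
    rewrite ltnNge leqnSn.
have [r rE] : exists r, levels n j.+1 = levels n m ++ r.
  rewrite -(subnK mjS); elim: (_ - _)%N => [|d [r rE]].
    by exists [::]; rewrite cats0.
  by exists (r ++ level n (d + m)); rewrite addSn levelsS rE catA.
have := levels_uniq n j.+1; rewrite rE cat_uniq => /and3P[_ /hasPn/= rm _].
move: jm; rewrite (mindex_enumE n0 jj) rE nth_cat (ltnNge j) mj /= -mem_levels.
apply/negP; apply: rm; rewrite mem_nth// ltn_subLR//.
by rewrite -size_cat -rE.
Qed.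

Lemma mnumS s : mnum n s.+1 = (mnum n s + Nnum n s.+1)%N.
Proof. by rewrite -!size_levels_mnum levelsS size_cat. Qed.

Lemma mnum_diag s : (s.+1 * mnum n s.+1 = (s + n).+1 * mnum n s)%N.
Proof. by rewrite /mnum addSn -mul_bin_diag. Qed.

(** The new multi-indices of degree [s + 1] are a fraction of order [n / s] of
    all of them: this is why a single block never matters in the limit. *)
Lemma Nnum_mnum s : (s.+1 * Nnum n s.+1 = n * mnum n s)%N.
Proof. have := mnum_diag s; rewrite mnumS; nia. Qed.

Lemma lnumS s : lnum n s.+1 = (lnum n s + n * mnum n s)%N.
Proof. by rewrite /lnum big_ord_recr /= Nnum_mnum. Qed.

(** The average degree is [n s / (n + 1)]: [l_s] outgrows [m_s] by the factor
    [s], which absorbs any [log] of a polynomial in [s]. *)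
Lemma lnum_mnum s : (n.+1 * lnum n s = n * s * mnum n s)%N.
Proof.
elim: s => [|s ih]; first by rewrite /lnum big_ord1 mul0n !muln0 mul0n.
rewrite lnumS mulnDr ih -[RHS]mulnA mnum_diag.
by move: (mnum n s) => m; rewrite mulnA -mulnDl mulnA; congr (_ * _)%N; nia.
Qed.

Lemma mnum_gt0 s : (0 < mnum n s)%N.
Proof. by rewrite bin_gt0 leq_addr. Qed.

Lemma mnum_le s : (mnum n s <= s.+1 ^ n)%N.
Proof.
rewrite /mnum -bin_sub ?leq_addr// addKn.
elim: n => [|p ih]; first by rewrite bin0.
rewrite -(@leq_pmul2l p.+1)// addnS -mul_bin_diag expnS mulnA.
by apply: leq_mul => //=; nia.
Qed.

End counting.

(** * Subexponential factors and upper limits *)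

Section subexponential.
Variable R : realType.

Lemma poly_le_expn (M : R) (b : nat) (e : R) : 1 < e ->
  \forall s \near \oo, M * s.+1%:R ^+ b <= e ^+ s.
Proof.
move=> e1; have e0 : 0 < e by apply: lt_trans e1.
have l0 : 0 < ln e by rewrite ln_gt0.
pose c := ln e ^+ b.+1 / b.+1`!%:R.
have c0 : 0 < c by rewrite divr_gt0 ?exprn_gt0// ltr0n fact_gt0.
pose D := `|M| * 2 ^+ b / c.
near=> s.
have s0 : 0 < s%:R :> R by rewrite ltr0n; near: s; exact: nbhs_infty_gt.
have Ds : D <= s%:R by near: s; exact: nbhs_infty_ger.
have -> : e ^+ s = expR (s%:R * ln e).
  by rewrite mulr_natl -lnXn// lnK// posrE exprn_gt0.
apply: (@le_trans _ _ (c * s%:R ^+ b.+1)); last first.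
  have := @expR_ge1Dxn R (s%:R * ln e) b (mulr_ge0 (ltW s0) (ltW l0)).
  apply: le_trans; rewrite exprMn /c [leLHS]mulrC mulrA.
  by rewrite lerDr.
apply: (@le_trans _ _ (`|M| * 2 ^+ b * s%:R ^+ b)).
  rewrite -mulrA -exprMn; apply: le_trans (ler_wpM2r _ (ler_norm M)) _.
    exact: exprn_ge0.
  rewrite ler_wpM2l// lerXn2r ?nnegrE//; last first.
    rewrite -natr1; suff : 1 <= s%:R :> R by lra.
    by rewrite ler1n -(ltr0n R).
rewrite exprS [leRHS]mulrA ler_wpM2r ?exprn_ge0//.
by rewrite [leRHS]mulrC -ler_pdivrMr.
Unshelve. all: by end_near. Qed.

(** By [lnum_mnum], taking [m_s]-th roots reduces this to the comparison of a
    polynomial in [s] with [e^(n s)]. *)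
Lemma subexponential_mnum n (M : R) (b : nat) (e : R) : (0 < n)%N -> 0 <= M ->
  1 < e ->
  \forall s \near \oo, (M * s.+1%:R ^+ b) ^+ mnum n s <= e ^+ lnum n s.
Proof.
move=> n0 M0 e1; have e0 : 0 <= e by apply: ltW; apply: lt_trans e1.
have := poly_le_expn (M ^+ n.+1) (b * n.+1) e1; apply: filterS => s Ms.
rewrite -(@ler_pXn2r _ n.+1) ?nnegrE ?exprn_ge0 ?mulr_ge0 ?exprn_ge0//.
rewrite -!exprM [(lnum n s * _)%N]mulnC lnum_mnum mulnC !exprM.
rewrite lerXn2r ?nnegrE ?exprn_ge0 ?mulr_ge0 ?exprn_ge0//.
rewrite exprMn -[s.+1%:R ^+ b ^+ _]exprM (le_trans Ms)//.
by rewrite -[(e ^+ n) ^+ s]exprM ler_weXn2l ?(ltW e1)// leq_pmull.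
Qed.

Lemma limn_esup_ge0 (u : nat -> R) : (forall i, 0 <= u i) ->
  (0 <= limn_esup (fun i => (u i)%:E))%E.
Proof. by move=> u0; apply: limf_esup_ge0 => // x; rewrite lee_fin. Qed.

Lemma limn_esup_le (u : nat -> \bar R) (t : \bar R) :
  (\forall i \near \oo, (u i <= t)%E) -> (limn_esup u <= t)%E.
Proof.
move=> [N _ uN]; rewrite /limn_esup limf_esupE.
apply: (@le_trans _ _ (ereal_sup (u @` [set i | (N <= i)%N]))).
  apply: ereal_inf_lbound => /=; exists [set i | (N <= i)%N] => //.
  by exists N.
by apply: ge_ereal_sup => _ [i /= Ni <-]; exact: uN.
Qed.

Lemma limn_esup_lt (u : nat -> \bar R) (t : \bar R) :
  (limn_esup u < t)%E -> \forall i \near \oo, (u i <= t)%E.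
Proof.
rewrite /limn_esup limf_esupE => /ereal_inf_lt[_ [A FA <-] At].
apply: filterS FA => i Ai; apply: le_trans (ltW At).
by apply: ereal_sup_ubound; exists i.
Qed.

(** An upper limit is determined by its eventual upper bounds; the factor
    [e > 1] leaves room for subexponential errors. *)
Lemma limn_esup_le_of_eventually (u v : nat -> R) :
  (forall i, 0 <= u i) ->
  (forall t e : R, 0 < t -> 1 < e -> (\forall i \near \oo, u i <= t) ->
     \forall i \near \oo, v i <= t * e) ->
  (limn_esup (fun i => (v i)%:E) <= limn_esup (fun i => (u i)%:E))%E.
Proof.
move=> u0 uv; have := limn_esup_ge0 u0.
case E : (limn_esup (fun i => (u i)%:E)) => [x| |];
  [|by move=> _; exact: leey|by []].
rewrite lee_fin => x0; apply/lee_addgt0Pr => d d0.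
pose t := x + d / 2.
have t0 : 0 < t by rewrite /t; lra.
have ut : \forall i \near \oo, u i <= t.
  have /limn_esup_lt : (limn_esup (fun i => (u i)%:E) < t%:E)%E.
    by rewrite E lte_fin /t; lra.
  by apply: filterS => i; rewrite lee_fin.
pose e := (x + d) / t.
have e1 : 1 < e by rewrite /e ltr_pdivlMr// mul1r {1}/t; lra.
rewrite -EFinD; apply: limn_esup_le.
have := uv _ _ t0 e1 ut; apply: filterS => i.
by rewrite lee_fin /e mulrC divfK ?gt_eqF.
Qed.

End subexponential.

(** * The Andreief identity *)

(** Expanding the determinant of the sum by multilinearity gives one term for
    each choice [f] of a point per row.  Such a term is not yet a square, but
    averaging over the permutations of the choice completes its factor
    [\prod_p u p (f p)] into a second determinant. *)
Lemma det_weighted_gram (R : comPzRingType) (T : finType) i (w : T -> R)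
    (u : 'I_i -> T -> R) :
  \det (\matrix_(p, q) \sum_x w x * (u p x * u q x)) *+ i`! =
  \sum_(f : {ffun 'I_i -> T})
    \prod_p w (f p) * (\det (\matrix_(p, q) u p (f q))) ^+ 2.
Proof.
pose E (f : {ffun 'I_i -> T}) : 'M[R]_i := \matrix_(p, q) u p (f q).
pose W (f : {ffun 'I_i -> T}) : R := \prod_p w (f p).
set M := \matrix_(p, q) \sum_x _.
have detM : \det M = \sum_f W f * \prod_p u p (f p) * \det (E f).
  rewrite {1}/determinant.
  under eq_bigr => s _.
    under eq_bigr => p _ do rewrite mxE.
    rewrite bigA_distr_bigA /= mulr_sumr; over.
  rewrite exchange_big /=; apply: eq_bigr => f _.
  rewrite -(det_tr (E f)) /determinant mulr_sumr; apply: eq_bigr => s _.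
  rewrite mulrCA; congr (_ * _); rewrite /W -!big_split /=.
  by apply: eq_bigr => p _; rewrite !mxE mulrA.
(* Relabelling the choices by [s] leaves the weights unchanged and multiplies
   the determinant by the sign of [s]. *)
have detMs (s : 'S_i) :
    \det M = \sum_f W f * \det (E f) * ((-1) ^+ s * \prod_p E f p (s p)).
  pose h (t : 'S_i) (f : {ffun 'I_i -> T}) := [ffun p => f (t p)].
  have hK t : cancel (h t) (h t^-1)%g.
    by move=> f; apply/ffunP => p; rewrite !ffunE permKV.
  rewrite detM (reindex (h s)) /=; last first.
    exists (h s^-1)%g => f _; first exact: hK.
    by have := hK (s^-1)%g f; rewrite invgK.
  apply: eq_bigr => f _.
  have -> : W (h s f) = W f.
    rewrite /W [RHS](reindex_inj (@perm_inj _ s)) /=.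
    by apply: eq_bigr => p _; rewrite ffunE.
  have -> : E (h s f) = col_perm s (E f).
    by apply/matrixP => p q; rewrite !mxE ffunE.
  rewrite col_permE det_mulmx det_perm odd_permV -!mulrA; congr (_ * _).
  rewrite mulrCA; congr (_ * _); rewrite mulrC; congr (_ * _).
  by apply: eq_bigr => p _; rewrite ffunE mxE.
rewrite -(card_Sn i) -sumr_const.
under eq_bigr => s _ do rewrite (detMs s).
rewrite exchange_big /=; apply: eq_bigr => f _.
by rewrite -mulr_sumr -mulrA expr2; congr (_ * (_ * _)).
Qed.

(** * Vandermonde and moment determinants over a real compact set *)

Section vandermonde.
Variables (R : realType) (n : nat).
Local Notation C := R[i].
Local Notation Cn := 'rV[C]_n.
Implicit Types (k l : mindex n) (z : Cn).

(** On real points this is the monomial itself ([monom_real]); real values turn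
    [det ^+ 2] into a nonnegative number. *)
Definition rmonom k z : R := \prod_j complex.Re (z ord0 j) ^+ k j.

Lemma rmonomD k l z : rmonom (k + l) z = rmonom k z * rmonom l z.
Proof. by rewrite -big_split; apply: eq_bigr => j _; rewrite ffunE exprD. Qed.

Lemma monom_real k z : real_space z -> monom k z = (rmonom k z)%:C%C.
Proof.
move=> zR; rewrite rmorph_prod; apply: eq_bigr => j _; rewrite rmorphXn.
by move: (zR j); case: (z ord0 j) => a b /= ->.
Qed.

Definition rvandermonde i (zeta : 'I_i -> Cn) : R :=
  \det (\matrix_(p < i, q < i) rmonom (mindex_enum n p) (zeta q)).

Variable K : set Cn.
Hypothesis K_real : K `<=` @real_space R n.

Definition tuples_in i : set ('I_i -> Cn) := [set zeta | forall q, K (zeta q)].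
Arguments tuples_in : clear implicits.

Lemma normc_rvandermonde i zeta : tuples_in i zeta ->
  normc (\det (\matrix_(p < i, q < i) monom (mindex_enum n p) (zeta q))) =
  `|rvandermonde zeta|.
Proof.
move=> Kz; have -> : \matrix_(p < i, q < i) monom (mindex_enum n p) (zeta q) =
    map_mx (real_complex R)
      (\matrix_(p < i, q < i) rmonom (mindex_enum n p) (zeta q)).
  by apply/matrixP => p q; rewrite !mxE monom_real//; exact/K_real/Kz.
by rewrite det_map_mx /= expr0n /= addr0 sqrtr_sqr.
Qed.

Lemma vandermonde_supE i :
  vandermonde_sup K i = sup [set `|rvandermonde zeta| | zeta in tuples_in i].
Proof.
congr (sup _); apply/seteqP; split => _ [zeta Kz <-]; exists zeta => //.
  by rewrite normc_rvandermonde.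
by rewrite normc_rvandermonde.
Qed.

Variable r : R.
Hypothesis r_ge1 : 1 <= r.
Hypothesis K_r : forall z j, K z -> normc (z ord0 j) <= r.

Let r_ge0 : 0 <= r. Proof. exact: le_trans r_ge1. Qed.

Lemma rmonom_le k z : K z -> `|rmonom k z| <= r ^+ mdeg k.
Proof.
move=> Kz; rewrite normr_prod /mdeg expr_sum; apply: ler_prod => j _.
rewrite normr_ge0 normrX lerXn2r ?nnegrE//.
apply: le_trans (K_r j Kz); move: (K_real Kz j).
by case: (z ord0 j) => a b /= ->; rewrite expr0n /= addr0 sqrtr_sqr.
Qed.

(** Adding one monomial and one point costs only the size of the new row: the
    minors of its expansion are determinants of the previous order. *)
Lemma rvandermonde_laplace i (B : R) :
  (forall zeta, tuples_in i zeta -> `|rvandermonde zeta| <= B) ->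
  forall zeta, tuples_in i.+1 zeta ->
    `|rvandermonde zeta| <= i.+1%:R * r ^+ mdeg (mindex_enum n i) * B.
Proof.
move=> hB zeta Kz; rewrite /rvandermonde (expand_det_row _ ord_max).
rewrite -mulrA mulr_natl -[X in _ *+ X](card_ord i.+1) -sumr_const.
apply: le_trans (ler_norm_sum _ _ _) _; apply: ler_sum => q _.
rewrite normrM ler_pM//; first by rewrite mxE; exact: rmonom_le.
rewrite normrM normrX normrN1 expr1n mul1r.
set A := row' _ _; suff -> : \det A = rvandermonde (zeta \o lift q).
  by apply: hB => p; exact: Kz.
congr (\det _); apply/matrixP => p p'; rewrite !mxE.
by congr (rmonom (mindex_enum n _) _); rewrite /= /bump leqNgt ltn_ord.
Qed.

(** The supremum defining [vandermonde_sup] is taken in [R], where it is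
    meaningful only for bounded sets. *)
Lemma rvandermonde_bounded i :
  exists B, forall zeta, tuples_in i zeta -> `|rvandermonde zeta| <= B.
Proof.
elim: i => [|i [B hB]]; last by eexists; exact: rvandermonde_laplace hB.
by exists 1 => zeta _; rewrite /rvandermonde det_mx00 normr1.
Qed.

Lemma rvandermonde_le i zeta :
  tuples_in i zeta -> `|rvandermonde zeta| <= vandermonde_sup K i.
Proof.
move=> Kz; rewrite vandermonde_supE; apply: ub_le_sup; last by exists zeta.
by have [B hB] := rvandermonde_bounded i; exists B => _ [z Kz' <-]; exact: hB.
Qed.

Lemma vandermonde_sup_ge0 i : 0 <= vandermonde_sup K i.
Proof.
rewrite vandermonde_supE; set S := (X in sup X).
have [->|/set0P[x Sx]] := eqVneq S set0; first by rewrite sup0.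
move: (Sx) => [zeta Kz zx]; apply: (@le_trans _ _ x); first by rewrite -zx.
by rewrite -zx (le_trans (rvandermonde_le Kz))// vandermonde_supE.
Qed.

Lemma vandermonde_supS i : vandermonde_sup K i.+1 <=
  i.+1%:R * r ^+ mdeg (mindex_enum n i) * vandermonde_sup K i.
Proof.
rewrite [leLHS]vandermonde_supE; set S := (X in sup X).
have [->|/set0P S0] := eqVneq S set0.
  by rewrite sup0 !mulr_ge0 ?exprn_ge0 ?vandermonde_sup_ge0.
apply: ge_sup => // _ [zeta Kz <-].
by apply: (rvandermonde_laplace _ Kz) => xi; exact: rvandermonde_le.
Qed.

Lemma vandermonde_sup_growth a i b s : (a <= i)%N -> (i <= b)%N ->
  (forall j, (j < i)%N -> (mdeg (mindex_enum n j) <= s)%N) ->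
  vandermonde_sup K i <=
    (b%:R * r ^+ s) ^+ (i - a) * vandermonde_sup K a.
Proof.
move=> /subnK <-; rewrite addnK; elim: (i - a)%N => [|d ih] db degs.
  by rewrite expr0 mul1r.
rewrite addSn; apply: le_trans (vandermonde_supS _) _.
rewrite exprS -[leRHS]mulrA; apply: ler_pM.
- by rewrite mulr_ge0 ?exprn_ge0.
- exact: vandermonde_sup_ge0.
- apply: ler_pM => //; first by rewrite exprn_ge0// (le_trans ler01).
    by rewrite ler_nat.
  by rewrite ler_weXn2l// degs.
- by apply: ih => [|j jd]; [exact: ltnW|apply: degs; exact: ltnW].
Qed.

(** Maximal determinants up to a factor 2 suffice; this spares the attainment
    of the supremum. *)
Lemma near_fekete i : K !=set0 ->
  exists2 zeta, tuples_in i zeta &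
    vandermonde_sup K i <= 2 * `|rvandermonde zeta|.
Proof.
move=> [z0 Kz0]; have [V0|V0] := eqVneq (vandermonde_sup K i) 0.
  by exists (fun=> z0) => //; rewrite V0 mulr_ge0.
have Vp : 0 < vandermonde_sup K i by rewrite lt_def V0 vandermonde_sup_ge0.
have hS : has_sup [set `|rvandermonde zeta| | zeta in tuples_in i].
  split; first by exists `|rvandermonde (fun _ : 'I_i => z0)|; exists (fun=> z0).
  by have [B hB] := rvandermonde_bounded i; exists B => _ [z Kz' <-]; exact: hB.
have [_ [zeta Kz <-]] := sup_adherent (divr_gt0 Vp (ltr0n R 2)) hS.
rewrite -vandermonde_supE => h; exists zeta => //; lra.
Qed.

Section moments.
Variables (T : finType) (w : T -> R) (x : T -> Cn).
Hypothesis w_ge0 : forall t, 0 <= w t.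
Hypothesis w_le1 : \sum_t w t <= 1.
Hypothesis x_K : forall t, K (x t).

Definition moment k : R := \sum_t w t * rmonom k (x t).
Definition moment_mx i : 'M[R]_i :=
  \matrix_(p < i, q < i) moment (mindex_enum n p + mindex_enum n q).

Lemma moment_detE i : \det (moment_mx i) *+ i`! =
  \sum_(f : {ffun 'I_i -> T}) \prod_p w (f p) * rvandermonde (x \o f) ^+ 2.
Proof.
rewrite -(det_weighted_gram w (fun p t => rmonom (mindex_enum n p) (x t))).
congr (\det _ *+ _); apply/matrixP => p q.
by rewrite !mxE; apply: eq_bigr => t _; rewrite rmonomD.
Qed.

(** All terms of the Andreief sum are nonnegative, so each one is a lower
    bound. *)
Lemma moment_det_ge i (g : 'I_i -> T) :
  \prod_p w (g p) * rvandermonde (x \o g) ^+ 2 <= \det (moment_mx i) *+ i`!.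
Proof.
pose f := [ffun p => g p]; have fE : f = g :> ('I_i -> T).
  by apply/funext => p; rewrite ffunE.
rewrite moment_detE (bigD1 f)//= fE -[leLHS]addr0 lerD//.
by apply: sumr_ge0 => h _; rewrite mulr_ge0 ?sqr_ge0 ?prodr_ge0.
Qed.

Lemma moment_det_ge0 i : 0 <= \det (moment_mx i).
Proof.
rewrite -(@pmulrn_lge0 _ _ i`!) ?fact_gt0// moment_detE.
by apply: sumr_ge0 => f _; rewrite mulr_ge0 ?sqr_ge0 ?prodr_ge0.
Qed.

(** The products of weights in the Andreief sum add up to the [i]-th power of
    the total mass. *)
Lemma moment_det_le i : \det (moment_mx i) <= vandermonde_sup K i ^+ 2.
Proof.
have le1 : \det (moment_mx i) <= \det (moment_mx i) *+ i`!.
  by rewrite -[leLHS]mulr1n ler_wpMn2l ?moment_det_ge0 ?fact_gt0.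
apply: le_trans le1 _; rewrite moment_detE.
apply: (@le_trans _ _ (\sum_(f : {ffun 'I_i -> T})
    \prod_p w (f p) * vandermonde_sup K i ^+ 2)).
  apply: ler_sum => f _; rewrite ler_wpM2l ?prodr_ge0//.
  rewrite -real_normK ?num_real// lerXn2r ?nnegrE ?vandermonde_sup_ge0//.
  by apply: rvandermonde_le => q; exact: x_K.
rewrite -mulr_suml -(bigA_distr_bigA (fun _ => w)) /= prodr_const card_ord.
by rewrite ler_piMl ?sqr_ge0// exprn_ile1// sumr_ge0.
Qed.

End moments.
End vandermonde.

(** * Discrete measures as functionals on germs *)

Section discrete_measure.
Variables (R : realType) (n : nat).
Local Notation C := R[i].
Local Notation Cn := 'rV[C]_n.
Variable K : set Cn.
Hypothesis K_compact : compact K.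
Variables (m : nat -> nat) (c : nat -> R) (zeta : forall s, 'I_(m s) -> Cn).
Hypothesis c_ge0 : forall s, 0 <= c s.
Hypothesis c_sum : forall N, \sum_(s < N) c s * (m s)%:R <= 1.
Hypothesis zeta_K : forall s q, K (@zeta s q).
Implicit Types (g h : Cn -> R) (f : Cn -> C).

(** The measure has the weight [c s] at each of the [m s] points [zeta s q] of
    the [s]-th block; [mass] integrates against it, one block at a time. *)
Definition mass_term g s : R := c s * \sum_q g (@zeta s q).
Definition mass g : R := limn (series (mass_term g)).

Definition bounded_by g (M : R) := forall z, K z -> `|g z| <= M.

Lemma eq_mass g h : (forall z, K z -> g z = h z) -> mass g = mass h.
Proof.
move=> gh; congr (limn (series _)); apply/funext => s; congr (_ * _).
by apply: eq_bigr => q _; exact/gh/zeta_K.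
Qed.

Lemma mass_term_norm_sum g M N : 0 <= M -> bounded_by g M ->
  \sum_(0 <= s < N) `|mass_term g s| <= M.
Proof.
move=> M0 gM; rewrite big_mkord -[leRHS]mulr1.
apply: le_trans (ler_wpM2l M0 (c_sum N)); rewrite mulr_sumr.
apply: ler_sum => s _; rewrite normrM ger0_norm// mulrCA ler_wpM2l//.
apply: le_trans (ler_norm_sum _ _ _) _.
rewrite mulr_natr -[X in _ *+ X](card_ord (m s)) -sumr_const.
by apply: ler_sum => q _; exact/gM/zeta_K.
Qed.

Lemma is_cvg_mass g M : 0 <= M -> bounded_by g M -> cvgn (series (mass_term g)).
Proof.
move=> M0 gM; apply: normed_cvg; apply: nondecreasing_is_cvgn.
  apply/nondecreasing_seqP => N.
  by rewrite /normed_series_of /series /= big_nat_recr//= lerDl.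
by exists M => _ [N _ <-]; exact: mass_term_norm_sum.
Qed.

Lemma mass_le g M : 0 <= M -> bounded_by g M -> `|mass g| <= M.
Proof.
move=> M0 gM; have cg := is_cvg_mass M0 gM.
have le N : `|series (mass_term g) N| <= M.
  apply: le_trans (mass_term_norm_sum N M0 gM).
  by rewrite seriesEnat /=; exact: ler_norm_sum.
rewrite ler_norml; apply/andP; split.
  apply: limr_ge => //; apply: nearW => N.
  by have := le N; rewrite ler_norml => /andP[].
apply: limr_le => //; apply: nearW => N.
by have := le N; rewrite ler_norml => /andP[].
Qed.

Lemma mass_linear g h (a b M M' : R) : 0 <= M -> 0 <= M' ->
  bounded_by g M -> bounded_by h M' ->
  mass (fun z => a * g z + b * h z) = a * mass g + b * mass h.
Proof.
move=> M0 M'0 gM hM'.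
have cg := is_cvg_mass M0 gM; have ch := is_cvg_mass M'0 hM'.
apply/cvg_lim => //.
have -> : series (mass_term (fun z => a * g z + b * h z)) =
    (fun N => a * series (mass_term g) N + b * series (mass_term h) N).
  apply/funext => N; rewrite !seriesEnat /= !mulr_sumr -big_split /=.
  apply: eq_bigr => s _; rewrite /mass_term big_split -!mulr_sumr /=; ring.
by apply: cvgD; apply: cvgMr.
Qed.

(** Complex integrals are taken by real and imaginary parts, so that all limits
    are limits of real series. *)
Definition cmass f : C :=
  (mass (fun z => complex.Re (f z)) +i* mass (fun z => complex.Im (f z)))%C.

Lemma eq_cmass f f' : (forall z, K z -> f z = f' z) -> cmass f = cmass f'.
Proof.
by move=> ff'; congr (_ +i* _)%C; apply: eq_mass => z Kz; rewrite ff'.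
Qed.

Lemma Re_le_normc (z : C) : `|complex.Re z| <= normc z.
Proof.
case: z => a b /=; rewrite -sqrtr_sqr ler_sqrt ?addr_ge0 ?sqr_ge0//.
by rewrite lerDl sqr_ge0.
Qed.

Lemma Im_le_normc (z : C) : `|complex.Im z| <= normc z.
Proof.
case: z => a b /=; rewrite -sqrtr_sqr ler_sqrt ?addr_ge0 ?sqr_ge0//.
by rewrite lerDr sqr_ge0.
Qed.

Lemma cmass_le f M : 0 <= M -> (forall z, K z -> normc (f z) <= M) ->
  normc (cmass f) <= 2 * M.
Proof.
move=> M0 fM.
have r : `|mass (fun z => complex.Re (f z))| <= M.
  by apply: mass_le => // z Kz; exact: le_trans (Re_le_normc _) (fM z Kz).
have i : `|mass (fun z => complex.Im (f z))| <= M.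
  by apply: mass_le => // z Kz; exact: le_trans (Im_le_normc _) (fM z Kz).
rewrite /cmass /= -[2 * M]ger0_norm ?mulr_ge0// -sqrtr_sqr ler_wsqrtr//.
move: r i; rewrite !ler_norml; nra.
Qed.

Lemma cmass_linear (a : C) f f' M M' : 0 <= M -> 0 <= M' ->
  (forall z, K z -> normc (f z) <= M) ->
  (forall z, K z -> normc (f' z) <= M') ->
  cmass (fun z => a * f z + f' z) = a * cmass f + cmass f'.
Proof.
move=> M0 M'0 fM fM'.
have rf : bounded_by (fun z => complex.Re (f z)) M.
  by move=> z Kz; exact: le_trans (Re_le_normc _) (fM z Kz).
have jf : bounded_by (fun z => complex.Im (f z)) M.
  by move=> z Kz; exact: le_trans (Im_le_normc _) (fM z Kz).
have rf' : bounded_by (fun z => complex.Re (f' z)) M'.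
  by move=> z Kz; exact: le_trans (Re_le_normc _) (fM' z Kz).
have jf' : bounded_by (fun z => complex.Im (f' z)) M'.
  by move=> z Kz; exact: le_trans (Im_le_normc _) (fM' z Kz).
case: a => a b.
have ab_bound (p q : R) g h : bounded_by g M -> bounded_by h M ->
    bounded_by (fun z => p * g z + q * h z) (`|p| * M + `|q| * M).
  move=> gM hM z Kz; apply: le_trans (ler_normD _ _) _.
  by rewrite !normrM lerD// ler_wpM2l// ?gM// hM.
have bnd0 (p q : R) : 0 <= `|p| * M + `|q| * M by rewrite addr_ge0// mulr_ge0.
have split3 (p q : R) g h k :
    bounded_by g M -> bounded_by h M -> bounded_by k M' ->
    mass (fun z => p * g z + q * h z + k z) = p * mass g + q * mass h + mass k.
  move=> gM hM kM'; rewrite -(mass_linear p q M0 M0 gM hM) -[mass k]mul1r.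
  rewrite -[mass (fun z => p * g z + q * h z)]mul1r.
  rewrite -(mass_linear 1 1 (bnd0 p q) M'0 (ab_bound p q _ _ gM hM) kM').
  by apply: eq_mass => z _; rewrite !mul1r.
rewrite /cmass; apply/eqP; rewrite eq_complex /=; apply/andP; split; apply/eqP.
  rewrite -mulNr -(split3 a (- b))//; apply: eq_mass => z _.
  by case: (f z) => ? ?; case: (f' z) => ? ? /=; rewrite mulNr.
rewrite -(split3 a b)//; apply: eq_mass => z _.
by case: (f z) => ? ?; case: (f' z).
Qed.

Lemma near_anal_bounded (f : near_anal K) :
  exists2 M : R, 0 <= M & forall z, K z -> normc (f z) <= M.
Proof.
case: f => f /=; rewrite unfold_in => /asboolP[D [oD KD Df]].
have cf : {within K, continuous (@normc R \o f)}.
  apply: continuous_in_subspaceT => z /set_mem/KD/Df/differentiable_continuous.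
  by move=> fz; apply: continuous_comp => //; exact: normc_continuous.
have /compact_bounded[M [_ ML]] := continuous_compact cf K_compact.
exists (`|M| + 1) => [|z Kz]; first by rewrite addr_ge0.
have := ML (`|M| + 1); rewrite (le_lt_trans (ler_norm M)) ?ltrDl// => /(_ isT).
by move=> /(_ _ (imageP _ Kz)); rewrite /= ger0_norm// normc_ge0.
Qed.

Definition germ_mass (x : germs K) : C^o := cmass (repr x).

Local Open Scope quotient_scope.

(** Only values on [K] enter, hence the choice of a representative of the germ is
    immaterial. *)
Lemma germ_massE (f : near_anal K) : germ_mass (\pi_(germs K) f) = cmass f.
Proof.
have /germs_eqP : \pi_(germs K) (repr (\pi_(germs K) f)) = \pi_(germs K) f.
  by rewrite reprK.
rewrite unfold_in => /asboolP[D [oD KD fD]]; apply: eq_cmass => z Kz.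
by apply/eqP; rewrite -subr_eq0; apply/eqP; exact: (fD z (KD z Kz)).
Qed.

Lemma germ_mass_linear : linear germ_mass.
Proof.
move=> a x y; have [f ->] := germsW x; have [g ->] := germsW y.
rewrite -[a *: _]/(germs_scale a _) germs_scaleE -germsD !germ_massE.
have [M M0 fM] := near_anal_bounded f; have [M' M'0 gM'] := near_anal_bounded g.
exact: (cmass_linear a M0 M'0 fM gM').
Qed.

HB.instance Definition _ :=
  GRing.isLinear.Build C (germs K) C^o *:%R germ_mass germ_mass_linear.

(** The balls [|F x| < a] are absolutely convex, and in every [A(D_j)] such a
    ball contains a neighbourhood of 0 for uniform convergence on the single
    compact set [K]. *)
Lemma germ_mass_continuous : continuous germ_mass.
Proof.
move=> x A; rewrite nbhsE => -[B [oB Bx] BA].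
exists (germ_mass @^-1` B); split => //; last by move=> y /BA.
move=> y By.
have /nbhs_ballP[e e0 eB] : nbhs (germ_mass y) B by exact: open_nbhs_nbhs.
have [a a0 ae] : exists2 a : R, 0 < a & e = a%:C%C.
  by case: e e0 {eB} => a b; rewrite /= ltcE /= => /andP[/eqP -> a0]; exists a.
exists [set z | normc (germ_mass z) < a]; last first.
  move=> z za; apply: eB; rewrite -ball_normE /= linearD opprD addrA subrr sub0r.
  by rewrite normrN normCE ae ltcR.
split => [z w p q|j].
  rewrite /mkset !normCE -rmorphD -[1]/(1%:C%C) lecR => za wa pq.
  have -> : germ_mass (p *: z + q *: w) = p * germ_mass z + q * germ_mass w.
    by rewrite linearD !linearZ.
  apply: le_lt_trans (le_normcD _ _) _; rewrite !normcM.
  pose t := Num.max (normc (germ_mass z)) (normc (germ_mass w)).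
  have ta : t < a by rewrite gt_max za wa.
  have t0 : 0 <= t by rewrite le_max normc_ge0.
  apply: le_lt_trans ta; apply: (@le_trans _ _ ((normc p + normc q) * t)).
    by rewrite mulrDl lerD// ler_wpM2l ?normc_ge0// /t le_max lexx ?orbT.
  by rewrite ler_piMl.
have e3 : (0 : C) < (a / 3)%:C%C by rewrite ltcR divr_gt0.
apply: filterS (anal_nbhs (0 : anal (nbd K j)) (@sub_nbd R n K j) K_compact e3).
move=> g g3; rewrite /preimage /mkset /germ germ_massE.
apply: (@le_lt_trans _ _ (2 * (a / 3))); last lra.
apply: cmass_le => [|z Kz]; first by rewrite divr_ge0// ltW.
have : `|0 - g z| < (a / 3)%:C%C := g3 z Kz.
by rewrite sub0r normrN normCE ltcR; exact: ltW.
Qed.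

Definition germ_mass_dual : dual (germs K) := Dual germ_mass_continuous.

End discrete_measure.

(** * Hankel determinants of a discrete measure *)

Lemma cvg_det (R : realType) (i : nat) (A : nat -> 'M[R]_i) (B : 'M[R]_i) :
  (forall p q, A N p q @[N --> \oo] --> B p q) ->
  \det (A N) @[N --> \oo] --> \det B.
Proof.
move=> AB; rewrite /determinant; apply: cvg_big; first exact: add_continuous.
move=> s _; apply: cvgM; first exact: cvg_cst.
by apply: cvg_big => [|p _]; [exact: mul_continuous|exact: AB].
Qed.

Section discrete_hankel.
Variables (R : realType) (n : nat).
Local Notation C := R[i].
Local Notation Cn := 'rV[C]_n.
Variable K : set Cn.
Hypothesis K_compact : compact K.
Hypothesis K_real : K `<=` @real_space R n.
Variables (m : nat -> nat) (c : nat -> R) (zeta : forall s, 'I_(m s) -> Cn).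
Hypothesis c_ge0 : forall s, 0 <= c s.
Hypothesis c_sum : forall N, \sum_(s < N) c s * (m s)%:R <= 1.
Hypothesis zeta_K : forall s q, K (@zeta s q).
Variable r : R.
Hypothesis r_ge1 : 1 <= r.
Hypothesis K_r : forall z j, K z -> normc (z ord0 j) <= r.

Let F := germ_mass_dual K_compact c_ge0 c_sum zeta_K.
Let a k : R := mass c zeta (rmonom k).

(* The points of the first [N] blocks form a finite index type, to which the
   results on finite moments apply; those on [F] follow by letting [N] grow. *)
Let T N := {s : 'I_N & 'I_(m s)}.
Let w N (t : T N) : R := c (tag t).
Let x N (t : T N) : Cn := zeta (tagged t).

Let sum_T N (g : forall s, 'I_(m s) -> R) :
  \sum_(s < N) c s * \sum_q g s q = \sum_(t : T N) w t * g (tag t) (tagged t).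
Proof.
rewrite (eq_bigr (fun s : 'I_N => \sum_q c s * g s q)) => [|s _].
  by rewrite (sig_big_dep _ _ (fun (s : 'I_N) (q : 'I_(m s)) => c s * g s q)).
by rewrite mulr_sumr.
Qed.

Let w_ge0 N (t : T N) : 0 <= w t. Proof. exact: c_ge0. Qed.

Let w_le1 N : \sum_(t : T N) w t <= 1.
Proof.
apply: le_trans (c_sum N).
rewrite (eq_bigr (fun t : T N => w t * 1)) => [|t _]; last by rewrite mulr1.
rewrite -(sum_T N (fun _ _ => 1)) le_eqVlt; apply/orP; left; apply/eqP.
by apply: eq_bigr => s _; rewrite sumr_const card_ord.
Qed.

Let x_K N (t : T N) : K (x t). Proof. exact: zeta_K. Qed.

Let moment_cvg k : moment (@w N) (@x N) k @[N --> \oo] --> a k.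
Proof.
have -> : (fun N => moment (@w N) (@x N) k) =
    series (mass_term c zeta (rmonom k)).
  apply/funext => N; rewrite seriesEnat /= big_mkord.
  by rewrite (sum_T N (fun s q => rmonom k (zeta q))).
apply: (@is_cvg_mass _ _ K _ _ _ c_ge0 c_sum zeta_K _ (r ^+ mdeg k)).
  by rewrite exprn_ge0// (le_trans ler01).
by move=> z Kz; apply: rmonom_le Kz.
Qed.

Let h i : R :=
  \det (\matrix_(p < i, q < i) a (mindex_enum n p + mindex_enum n q)).

Let moment_det_cvg i : \det (moment_mx (@w N) (@x N) i) @[N --> \oo] --> h i.
Proof.
apply: cvg_det => p q; rewrite mxE.
under eq_fun => N do rewrite mxE.
exact: moment_cvg.
Qed.

Let hankelE i : hankel (transform (dual_entire F)) i = (h i)%:C%C.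
Proof.
rewrite /h -det_map_mx /hankel; congr (\det _).
apply/matrixP => p q; rewrite !mxE.
set k := (_ + _)%R; rewrite /= /germ (germ_massE _ zeta_K) /cmass.
apply/eqP; rewrite eq_complex /=.
apply/andP; split; apply/eqP.
  apply: (@eq_mass _ _ K) => // z Kz /=; rewrite monom_real//.
  exact: K_real.
rewrite (@eq_mass _ _ K _ _ _ zeta_K _ (fun=> 0)); last first.
  by move=> z Kz /=; rewrite monom_real//; exact: K_real.
have b0 : @bounded_by R n K (fun=> 0) 0 by move=> z _; rewrite normr0.
have := mass_le c_ge0 c_sum zeta_K (lexx 0) b0.
by rewrite normr_le0 => /eqP.
Qed.

Lemma discrete_hankel_le i :
  normc (hankel (transform (dual_entire F)) i) <= vandermonde_sup K i ^+ 2.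
Proof.
have hcvg := @moment_det_cvg i; have hc := cvgP _ hcvg.
have h0 : 0 <= h i.
  rewrite -(cvg_lim _ hcvg)//; apply: limr_ge => //.
  by apply: nearW => N; exact: moment_det_ge0.
rewrite hankelE /= expr0n /= addr0 sqrtr_sqr ger0_norm//.
rewrite -(cvg_lim _ hcvg)//; apply: limr_le => //.
by apply: nearW => N; apply: (moment_det_le K_real r_ge1 K_r).
Qed.

(** The term of the Andreief sum that picks each point of the [s]-th block
    exactly once. *)
Lemma discrete_hankel_ge s :
  c s ^+ m s * rvandermonde (@zeta s) ^+ 2 <=
  normc (hankel (transform (dual_entire F)) (m s)) *+ (m s)`!.
Proof.
have hcvg := @moment_det_cvg (m s); have hc := cvgP _ hcvg.
rewrite hankelE /= expr0n /= addr0 sqrtr_sqr.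
apply: (@le_trans _ _ (h (m s) *+ (m s)`!)); last first.
  by rewrite lerMn2r ler_norm orbT.
rewrite -mulr_natr -ler_pdivrMr ?ltr0n ?fact_gt0//.
rewrite -(cvg_lim _ hcvg)//; apply: limr_ge => //; near=> N.
have sN : (s < N)%N by near: N; exact: nbhs_infty_gt.
rewrite ler_pdivrMr ?ltr0n ?fact_gt0// mulr_natr.
pose g (q : 'I_(m s)) : T N :=
  Tagged (fun s : 'I_N => 'I_(m s)) (q : 'I_(m (Ordinal sN))).
have := moment_det_ge (@x N) (@w_ge0 N) g.
by rewrite (eq_bigr (fun=> c s))// prodr_const card_ord.
Unshelve. all: by end_near. Qed.

End discrete_hankel.

(** * A measure charging near-maximal configurations *)

Section fekete.
Variables (R : realType) (n : nat).
Local Notation C := R[i].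
Local Notation Cn := 'rV[C]_n.
Variable K : set Cn.
Hypothesis K_compact : compact K.
Hypothesis K_real : K `<=` @real_space R n.
Variable r : R.
Hypothesis r_ge1 : 1 <= r.
Hypothesis K_r : forall z j, K z -> normc (z ord0 j) <= r.

(* The [s]-th block has at most [(s + 1)^n] points, so its mass is at most
   [1 / ((s + 1)(s + 2))], whose sum telescopes to 1. *)
Let c s : R := (s.+1%:R ^+ n * (s.+1%:R * s.+2%:R))^-1.

Let c_ge0 s : 0 <= c s.
Proof. by rewrite invr_ge0 !mulr_ge0// exprn_ge0. Qed.

Let c_sum (m : nat -> nat) : (forall s, m s <= mnum n s)%N ->
  forall N, \sum_(s < N) c s * (m s)%:R <= 1.
Proof.
move=> mle N; suff : \sum_(s < N) c s * (m s)%:R <= 1 - N.+1%:R^-1.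
  by move=> /le_trans; apply; rewrite gerBl invr_ge0.
elim: N => [|N ih]; first by rewrite big_ord0 invr1 subrr.
rewrite big_ord_recr /=.
apply: le_trans (lerD ih (_ : _ <= (N.+1%:R * N.+2%:R)^-1)) _.
  rewrite /c invfM mulrAC ler_piMl ?invr_ge0 ?mulr_ge0//.
  rewrite ler_pdivrMl ?exprn_gt0// mulr1 -natrX ler_nat.
  exact: leq_trans (mle N) (mnum_le n N).
have N1 : N.+1%:R != 0 :> R by rewrite pnatr_eq0.
have N2 : N.+2%:R != 0 :> R by rewrite pnatr_eq0.
rewrite le_eqVlt; apply/orP; left; apply/eqP.
have E : N.+2%:R = N.+1%:R + 1 :> R by rewrite natr1.
rewrite E in N2 *; move: (N.+1%:R : R) N1 N2 => y N1 N2.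
by field; rewrite N1 N2.
Qed.

(** For [K] nonempty, the weight of the term kept from the [s]-th block is
    [c s ^ m_s], and [m_s! <= m_s ^ m_s <= ((s + 1)^n) ^ m_s].  For [K] empty
    the zero functional works, since then [V_i = 0] for [i > 0]. *)
Lemma fekete_functional : exists F : dual (germs K),
  (forall i, normc (hankel (transform (dual_entire F)) i) <=
     vandermonde_sup K i ^+ 2) /\
  (forall s, vandermonde_sup K (mnum n s) ^+ 2 <=
     (8 * s.+1%:R ^+ (2 * n + 2)) ^+ mnum n s *
       normc (hankel (transform (dual_entire F)) (mnum n s))).
Proof.
have [K0|Kn0] := pselect (K !=set0); last first.
  have empty_K (s : nat) (q : 'I_0) :
      K ((fun (_ : nat) (_ : 'I_0) => 0 : Cn) s q).
    by case: q.
  exists (germ_mass_dual K_compact c_ge0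
    (@c_sum (fun=> 0%N) (fun=> leq0n _)) empty_K).
  split=> [i|s].
    exact: (discrete_hankel_le K_compact K_real _ _ _ r_ge1 K_r).
  have -> : vandermonde_sup K (mnum n s) = 0.
    rewrite vandermonde_supE//; set S := (X in sup X).
    suff -> : S = set0 by rewrite sup0.
    apply/seteqP; split => // _ [zeta Kz <-]; apply: Kn0.
    by exists (zeta (Ordinal (mnum_gt0 n s))); exact: Kz.
  by rewrite expr0n /= mulr_ge0 ?normc_ge0 ?exprn_ge0 ?mulr_ge0 ?exprn_ge0.
have zeta_ex s := @cid2 _ _ _ (near_fekete K_real r_ge1 K_r (mnum n s) K0).
pose zeta s := projT1 (zeta_ex s).
have zeta_K s q : K (zeta s q) by rewrite /zeta; case: (zeta_ex s).
have zeta_V s : vandermonde_sup K (mnum n s) <= 2 * `|rvandermonde (zeta s)|.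
  by rewrite /zeta; case: (zeta_ex s).
exists (germ_mass_dual K_compact c_ge0 (c_sum (fun s => leqnn _)) zeta_K).
split=> [i|s].
    exact: (discrete_hankel_le K_compact K_real _ _ _ r_ge1 K_r).
have := discrete_hankel_ge K_compact K_real c_ge0
  (c_sum (fun s => leqnn _)) zeta_K r_ge1 K_r s.
move: (normc_ge0 (hankel (transform (dual_entire (germ_mass_dual K_compact c_ge0
    (c_sum (fun s0 : nat => leqnn (mnum n s0))) zeta_K))) (mnum n s))).
move: (normc _) => H H0 cH.
set m := mnum n s in cH *; pose X : R := s.+1%:R.
have X1 : 1 <= X by rewrite ler1n.
have X0 : 0 <= X by apply: le_trans X1.
have m0 : (0 < m)%N by exact: mnum_gt0.
apply: (@le_trans _ _ (4 * rvandermonde (zeta s) ^+ 2)).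
  rewrite -[_ ^+ 2 in leRHS]real_normK ?num_real//.
  have -> : 4 * `|rvandermonde (zeta s)| ^+ 2 =
    (2 * `|rvandermonde (zeta s)|) ^+ 2 by ring.
  rewrite lerXn2r ?nnegrE ?mulr_ge0 ?(vandermonde_sup_ge0 K_real r_ge1 K_r)//.
  exact: zeta_V.
have cI : c s ^+ m != 0.
  by rewrite expf_neq0// invr_neq0// !mulf_neq0// ?expf_neq0 ?pnatr_eq0.
have v2 : rvandermonde (zeta s) ^+ 2 <=
    (X ^+ n * (X * s.+2%:R)) ^+ m * (H *+ m`!).
  have -> : (X ^+ n * (X * s.+2%:R)) ^+ m = (c s ^+ m)^-1.
    by rewrite /c -exprVn invrK.
  by rewrite ler_pdivlMl// lt_def cI exprn_ge0.
apply: le_trans (ler_wpM2l (ler0n R 4) v2) _.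
have factm : m`!%:R <= (X ^+ n) ^+ m.
  rewrite -!natrX ler_nat; apply: (@leq_trans (m ^ m)%N).
    move: (m) => {m0 cI v2 cH}d; elim: d => // d ih.
    rewrite factS expnS leq_mul2l /= (leq_trans ih)//.
    by case: d {ih} => // d; rewrite leq_exp2r.
  by rewrite leq_exp2r// mnum_le.
have four : 4 <= 4 ^+ m :> R by rewrite -[leLHS]expr1 ler_weXn2l// ler1n.
have s2X : s.+2%:R <= 2 * X :> R by rewrite /X -[s.+2%:R]natr1; lra.
rewrite -[H *+ _]mulr_natl !mulrA ler_wpM2r//.
have -> : (8 * X ^+ (2 * n + 2)) ^+ m =
    4 ^+ m * (X ^+ n * (X * (2 * X))) ^+ m * (X ^+ n) ^+ m.
  by rewrite -!exprMn; congr (_ ^+ m); rewrite exprD mulnC exprM; ring.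
apply: ler_pM => //.
- by rewrite mulr_ge0// !exprn_ge0// !mulr_ge0// exprn_ge0.
apply: ler_pM => //; first by rewrite !exprn_ge0// !mulr_ge0// exprn_ge0.
rewrite lerXn2r ?nnegrE//.
- by do ?[apply: mulr_ge0|apply: exprn_ge0].
- by do ?[apply: mulr_ge0|apply: exprn_ge0].
- by rewrite -mulrA ler_wpM2l ?exprn_ge0// ler_wpM2l.
Qed.

End fekete.

(** * Comparison of the two upper limits *)

Section comparison.
Variables (R : realType) (n : nat).
Local Notation C := R[i].
Local Notation Cn := 'rV[C]_n.
Variable K : set Cn.
Hypothesis n_gt0 : (0 < n)%N.
Hypothesis K_real : K `<=` @real_space R n.

Lemma root_le (x t : R) l : 0 <= x -> 0 <= t -> (0 < l)%N ->
  (x `^ l%:R^-1 <= t) = (x <= t ^+ l).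
Proof.
move=> x0 t0 l0; have l0' : l%:R != 0 :> R by rewrite pnatr_eq0 -lt0n.
have rootK (y : R) : 0 <= y -> (y `^ l%:R^-1) ^+ l = y.
  by move=> y0; rewrite -powR_mulrn ?powR_ge0// -powRrM mulVf// powRr1.
by rewrite -(ler_pXn2r l0) ?nnegrE ?powR_ge0// rootK.
Qed.

Lemma lnum_gt0 s : (0 < s)%N -> (0 < lnum n s)%N.
Proof.
move=> s0; have := lnum_mnum n s; have := mnum_gt0 n s.
by case: (lnum n s) => // m0; rewrite muln0 => /esym/eqP; rewrite !muln_eq0; lia.
Qed.

(** [s(i)] tends to infinity with [i]. *)
Lemma mdeg_mindex_enum_near (P : nat -> Prop) : (\forall s \near \oo, P s) ->
  \forall i \near \oo, P (mdeg (mindex_enum n i.-1)).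
Proof.
move=> [N _ NP]; exists (size (levels n N)).+1 => // i /= Ni; apply: NP => /=.
by rewrite leqNgt mdeg_mindex_enum// -leqNgt -ltnS (ltn_predK Ni).
Qed.

Lemma mdeg_last s : (0 < s)%N -> mdeg (mindex_enum n (mnum n s).-1) = s.
Proof.
case: s => // s _; have m0 := mnum_gt0 n s.+1.
apply/eqP; rewrite eqn_leq -ltnS mdeg_mindex_enum// size_levels_mnum.
rewrite ltn_predL m0 /= leqNgt mdeg_mindex_enum// size_levels_mnum -leqNgt.
have := Nnum_mnum n s; have := mnumS n s; have := mnum_gt0 n s; nia.
Qed.

Lemma mnum_near (P : nat -> Prop) : (\forall i \near \oo, P i) ->
  \forall s \near \oo, P (mnum n s).
Proof.
move=> [N _ NP]; exists N => // s /= Ns; apply: NP => /=.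
by rewrite -size_levels_mnum (leq_trans Ns)// ltnW// size_levels.
Qed.

Variable r : R.
Hypothesis r_ge1 : 1 <= r.
Hypothesis K_r : forall z j, K z -> normc (z ord0 j) <= r.

(** From [m_s] to [i] there are at most [N_(s+1)] steps of
    [vandermonde_supS].  Their powers of [r] contribute at most
    [r ^ ((s + 1) N_(s+1)) = r ^ (n m_s)], their integer factors at most
    [m_(s+1) ^ m_(s+1)]; replacing [t ^ l_s] by [t ^ l_(s+1)] costs
    [t^-1 ^ (n m_s)], bounded through [1 + t^-1 >= 1] whatever the position of
    [t] with respect to 1. *)
Lemma vandermonde_sup_le i s (t : R) : (0 < i)%N ->
  mdeg (mindex_enum n i.-1) = s.+1 -> 0 < t ->
  vandermonde_sup K (mnum n s) <= t ^+ lnum n s ->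
  vandermonde_sup K i <= t ^+ lnum n s.+1 *
    ((r * (1 + t^-1)) ^+ n * s.+2%:R ^+ n) ^+ mnum n s.+1.
Proof.
move=> i0 degi t0 Vt; have r0 : 0 <= r by apply: le_trans r_ge1.
have im : (i <= mnum n s.+1)%N.
  by rewrite -size_levels_mnum -(ltn_predK i0) -mdeg_mindex_enum// degi.
have mi : (mnum n s <= i)%N.
  rewrite -size_levels_mnum (leq_trans _ (leq_pred i))// leqNgt.
  by rewrite -mdeg_mindex_enum// degi ltnn.
have degs j : (j < i)%N -> (mdeg (mindex_enum n j) <= s.+1)%N.
  move=> ji; rewrite -ltnS mdeg_mindex_enum//.
  by rewrite size_levels_mnum (leq_trans ji).
have m1 : 1 <= (mnum n s.+1)%:R * r ^+ s.+1 :> R.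
  by rewrite mulr_ege1 ?ler1n ?mnum_gt0// exprn_ege1.
have B1 : 1 <= 1 + t^-1 by rewrite lerDl invr_ge0 ltW.
apply: le_trans (vandermonde_sup_growth K_real r_ge1 K_r mi im degs) _.
set m := mnum n s.+1.
have step1 : (m%:R * r ^+ s.+1) ^+ (i - mnum n s) <=
    (s.+2%:R ^+ n) ^+ m * (r ^+ n) ^+ m.
  apply: (@le_trans _ _ ((m%:R * r ^+ s.+1) ^+ Nnum n s.+1)).
    by rewrite ler_weXn2l// leq_subLR -mnumS.
  rewrite exprMn -[(r ^+ s.+1) ^+ _]exprM Nnum_mnum.
  apply: ler_pM; rewrite ?exprn_ge0//.
    apply: (@le_trans _ _ (m%:R ^+ m)).
      by rewrite ler_weXn2l ?ler1n ?mnum_gt0// /m mnumS leq_addl.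
    by rewrite lerXn2r ?nnegrE ?exprn_ge0// -natrX ler_nat mnum_le.
  by rewrite -exprM ler_weXn2l// leq_mul2l /m mnumS leq_addr orbT.
have step2 : t ^+ lnum n s <= t ^+ lnum n s.+1 * ((1 + t^-1) ^+ n) ^+ m.
  have -> : t ^+ lnum n s = t ^+ lnum n s.+1 * t^-1 ^+ (n * mnum n s).
    by rewrite lnumS exprD -mulrA -exprMn divff ?gt_eqF// expr1n mulr1.
  rewrite ler_wpM2l ?exprn_ge0 ?(ltW t0)// -exprM.
  apply: (@le_trans _ _ ((1 + t^-1) ^+ (n * mnum n s))).
    by rewrite lerXn2r ?nnegrE ?addr_ge0 ?invr_ge0 ?(ltW t0)// lerDr.
  by rewrite ler_weXn2l// leq_mul2l /m mnumS leq_addr orbT.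
apply: le_trans (ler_pM _ _ step1 (le_trans Vt step2)) _.
- by rewrite exprn_ge0// (le_trans ler01).
- exact: (vandermonde_sup_ge0 K_real r_ge1 K_r).
rewrite !exprMn le_eqVlt; apply/orP; left; apply/eqP.
move: (_ ^+ n ^+ m) (r ^+ n ^+ m) ((1 + t^-1) ^+ n ^+ m) (t ^+ _) => x y z w.
by ring.
Qed.

Variable a : germ_infty R n.

(** With [s = s(i) - 1], [vandermonde_sup_le] bounds [V_i] by
    [t ^ l_(s+1)] up to a subexponential factor, and [2 l_(s+1)] is the
    exponent normalising [H_i]. *)
Lemma hankel_diam_le :
  (forall i, normc (hankel a i) <= vandermonde_sup K i ^+ 2) ->
  (hankel_diam a <= transfinite_diam K)%E.
Proof.
move=> aV; apply: limn_esup_le_of_eventually => [s|t e t0 e1 Vt].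
  exact: powR_ge0.
have M0 : 0 <= (r * (1 + t^-1)) ^+ n.
  rewrite exprn_ge0// mulr_ge0//; first exact: le_trans r_ge1.
  by rewrite addr_ge0// invr_ge0 ltW.
have sub := subexponential_mnum n n_gt0 M0 e1.
have Vt' : \forall s \near \oo,
    vandermonde_sup K (mnum n s.-1) `^ (lnum n s.-1)%:R^-1 <= t.
  case: Vt => N _ NV; exists N.+1 => // -[//|s] /= Ns; exact: NV.
have : \forall s \near \oo, [/\ (1 < s)%N,
    (((r * (1 + t^-1)) ^+ n) * s.+1%:R ^+ n) ^+ mnum n s <= e ^+ lnum n s &
    vandermonde_sup K (mnum n s.-1) `^ (lnum n s.-1)%:R^-1 <= t].
  near=> s; split; near: s => //; exact: nbhs_infty_gt.
move=> /mdeg_mindex_enum_near; apply: filter_app; near=> i.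
have i0 : (0 < i)%N by near: i; exact: nbhs_infty_gt.
case E : (mdeg (mindex_enum n i.-1)) => [|s]; first by case.
move=> [s0 Ms Vs]; have s0' : (0 < s)%N by [].
have V0 j := vandermonde_sup_ge0 K_real r_ge1 K_r j.
have e0 : 0 <= e by rewrite ltW// (lt_trans ltr01).
have te0 : 0 <= t * e by rewrite mulr_ge0// ltW.
rewrite root_le ?normc_ge0// ?muln_gt0 ?lnum_gt0//.
apply: le_trans (aV i) _; rewrite mulnC exprM lerXn2r ?nnegrE ?exprn_ge0//.
move: Vs; rewrite /= root_le ?lnum_gt0// ?(ltW t0)// => Vs.
apply: le_trans (vandermonde_sup_le i0 E t0 Vs) _.
by rewrite [(t * e) ^+ _]exprMn ler_wpM2l ?exprn_ge0// ltW.
Unshelve. all: by end_near. Qed.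

(** Along [i = m_s] both determinants are normalised by the same [l_s]. *)
Lemma transfinite_diam_le (M : R) (b : nat) : 0 <= M ->
  (forall s, vandermonde_sup K (mnum n s) ^+ 2 <=
     (M * s.+1%:R ^+ b) ^+ mnum n s * normc (hankel a (mnum n s))) ->
  (transfinite_diam K <= hankel_diam a)%E.
Proof.
move=> M0 Va; apply: limn_esup_le_of_eventually => [i|t e t0 e1 Ht].
  exact: powR_ge0.
have e0 : 0 <= e by rewrite ltW// (lt_trans ltr01).
have sub := subexponential_mnum b n_gt0 M0 e1.
have := mnum_near Ht; apply: filter_app; near=> s.
have s0 : (0 < s)%N by near: s; exact: nbhs_infty_gt.
have Ms : (M * s.+1%:R ^+ b) ^+ mnum n s <= e ^+ lnum n s by near: s.
have V0 j := vandermonde_sup_ge0 K_real r_ge1 K_r j.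
rewrite mdeg_last// root_le ?normc_ge0// ?muln_gt0 ?lnum_gt0// ?(ltW t0)// => Hs.
rewrite root_le ?lnum_gt0// ?mulr_ge0 ?(ltW t0)//.
rewrite -(@ler_pXn2r _ 2) ?nnegrE ?exprn_ge0 ?mulr_ge0 ?(ltW t0)//.
have -> : ((t * e) ^+ lnum n s) ^+ 2 = e ^+ (2 * lnum n s) * t ^+ (2 * lnum n s).
  by rewrite -exprM mulnC exprMn mulrC.
apply: le_trans (Va s) _.
apply: ler_pM => //; rewrite ?normc_ge0//.
  by do ?[apply: mulr_ge0|apply: exprn_ge0].
apply: le_trans Ms _; by rewrite ler_weXn2l ?(ltW e1)// leq_pmull.
Unshelve. all: by end_near. Qed.

End comparison.

Theorem theorem4p7 (R : realType) (n : nat) (n_ge1 : (1 <= n)%N)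
    (K : set 'rV[R[i]]_n) (K_compact : compact K)
    (K_real : K `<=` @real_space R n) :
  SSP K.
Proof.
have [r r0 K_r] := compact_normc_bounded K_compact.
have r1 : 1 <= r%:R :> R by rewrite ler1n.
have [F [FV VF]] := fekete_functional K_compact K_real r1
  (fun z j => @K_r z j).
exists F; apply/le_anti/andP; split.
  exact: (hankel_diam_le n_ge1 K_real r1 (fun z j => @K_r z j) FV).
exact: (transfinite_diam_le n_ge1 K_real r1 (fun z j => @K_r z j) _ VF).
Qed.
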